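(* Let $D$ be a weighted oriented cycle of length $n$ with $n\equiv 2\pmod 3$, with underlying graph $G=C_n=x_1\cdots x_nx_1$, such that every vertex of $V^+$ is a sink. Then $$\operatorname{reg}(I(D))=\operatorname{reg}(I(G))+\sum_{x_i\in V^+}(w(x_i)-1).$$
   Context: A weighted oriented graph $D=(V(D),E(D),w)$ has directed edges $(x,y)$ and weights $w:V(D)\to\{1,2,\dots\}$; a source is assumed to have weight $1$. Its edge ideal is $I(D)=(x_ix_j^{w(x_j)}:(x_i,x_j)\in E(D))$ in the polynomial ring over a field whose variables are the vertices; $I(G)$ is the usual squarefree edge ideal of the simple underlying graph $G$. $V^+=\{x\in V(D): w(x)\ge 2\}$. A sink is a vertex all of whose incident edges are oriented into it. $\operatorname{reg}$ is Castelnuovo–Mumford regularity. *)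

(* Defs.v *)
From Stdlib Require Import ClassicalEpsilon.
From mathcomp Require Import all_boot all_algebra.
From mathcomp Require Import mpoly.

Set Implicit Arguments.
Unset Strict Implicit.
Unset Printing Implicit Defensive.

Import GRing.Theory.
Local Open Scope ring_scope.

(* Ideals of S = k[x_1, ..., x_n] are represented by their membership predicate;
   [idealgen P g] is the ideal generated by the [g t] with [P t]. *)
Definition idealgen (n : nat) (k : fieldType) (T : finType) (P : pred T)
    (g : T -> {mpoly k[n]}) : {mpoly k[n]} -> Prop :=
  fun p => exists c : T -> {mpoly k[n]}, p = \sum_(t | P t) c t * g t.

(** * Graded free resolutions and regularity *)

(* The i-th free module is F_i = \bigoplus_(a < frank i) S(- fdeg i a), whose
   elements are row vectors; the maps F_(i+1) -> F_i and F_0 -> S are right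
   multiplication by [fdiff i] and [faug].  The axioms of a resolution are
   stated separately, in [minimal_graded_resolution]. *)
Record free_complex (n : nat) (k : fieldType) := FreeComplex {
  frank : nat -> nat;
  fdeg : forall i, 'I_(frank i) -> nat;
  fdiff : forall i, 'M[{mpoly k[n]}]_(frank i.+1, frank i);
  faug : 'cV[{mpoly k[n]}]_(frank 0)
}.

(* The maps are homogeneous of degree 0: as a basis element of S(-d) has degree
   d, the entry (a, b) of the i-th differential must be zero or homogeneous of
   degree fdeg i.+1 a - fdeg i b. *)
Definition graded (n : nat) (k : fieldType) (F : free_complex n k) : Prop :=
  (forall a, faug F a 0 \is (fdeg a).-homog)
  /\ (forall i a b m, m \in msupp (fdiff F i a b) ->
        (mdeg m + fdeg b)%N = fdeg a).

Definition resolves (n : nat) (k : fieldType) (I : {mpoly k[n]} -> Prop)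
    (F : free_complex n k) : Prop :=
  [/\ forall p, I p <-> exists v : 'rV_(frank F 0), (v *m faug F) 0 0 = p,
      forall v : 'rV_(frank F 0),
        v *m faug F = 0 <-> exists u, v = u *m fdiff F 0
    & forall i (v : 'rV_(frank F i.+1)),
        v *m fdiff F i = 0 <-> exists u, v = u *m fdiff F i.+1].

(* The differentials map F_(i+1) into (x_1, ..., x_n) F_i. *)
Definition minimal (n : nat) (k : fieldType) (F : free_complex n k) : Prop :=
  forall i a b, (fdiff F i a b)@_0%MM = 0.

Definition minimal_graded_resolution (n : nat) (k : fieldType)
    (I : {mpoly k[n]} -> Prop) (F : free_complex n k) : Prop :=
  [/\ graded F, resolves I F & minimal F].

Definition betti (n : nat) (k : fieldType) (F : free_complex n k)
    (i j : nat) : nat :=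
  #|[set a : 'I_(frank F i) | fdeg a == j]|.

(* r = max { j - i | beta_(i,j)(I) <> 0 }.  For a nonzero ideal this maximum is
   nonnegative, since beta_(0,j) <> 0 for some j >= 0. *)
Definition is_reg (n : nat) (k : fieldType) (I : {mpoly k[n]} -> Prop)
    (r : nat) : Prop :=
  exists F : free_complex n k,
    [/\ minimal_graded_resolution I F,
        exists i, betti F i (r + i) != 0%N
      & forall i j, betti F i j != 0%N -> (j <= r + i)%N].

(* For a nonzero homogeneous ideal there is exactly one such r: minimal graded
   free resolutions exist, are finite, and are unique up to isomorphism. *)
Definition reg (n : nat) (k : fieldType) (I : {mpoly k[n]} -> Prop) : nat :=
  epsilon (inhabits 0%N) (is_reg I).

(** * Weighted oriented graphs *)

Record wograph (n : nat) := WOGraph {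
  dedge : rel 'I_n;
  weight : 'I_n -> nat;
  dedge_asym : forall x y, dedge x y -> ~~ dedge y x;
  weight_gt0 : forall x, (0 < weight x)%N;
  weight_source : forall x, (forall y, ~~ dedge y x) -> weight x = 1%N
}.

Definition underlying (n : nat) (D : wograph n) : rel 'I_n :=
  fun x y => dedge D x y || dedge D y x.

(* [ordS] is the cyclic successor on 'I_n. *)
Definition cycle_graph (n : nat) : rel 'I_n :=
  fun x y => (y == ordS x) || (x == ordS y).

Definition sink (n : nat) (D : wograph n) (x : 'I_n) : bool :=
  [forall y, underlying D x y ==> dedge D y x].

Definition Vplus (n : nat) (D : wograph n) : {set 'I_n} :=
  [set x | (2 <= weight D x)%N].

Definition edge_ideal (n : nat) (k : fieldType) (e : rel 'I_n) :
    {mpoly k[n]} -> Prop :=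
  idealgen (fun xy : 'I_n * 'I_n => e xy.1 xy.2)
           (fun xy => 'X_xy.1 * 'X_xy.2).

Definition wedge_ideal (n : nat) (k : fieldType) (D : wograph n) :
    {mpoly k[n]} -> Prop :=
  idealgen (fun xy : 'I_n * 'I_n => dedge D xy.1 xy.2)
           (fun xy => 'X_xy.1 * 'X_xy.2 ^+ weight D xy.2).

Arguments edge_ideal {n} k e.
Arguments wedge_ideal {n} k D.
Arguments cycle_graph n : clear implicits.

(* Main.v *)
Require Import Defs.
From mathcomp Require Import all_boot all_algebra zify.
From mathcomp Require Import mpoly.
From Stdlib Require Import ClassicalEpsilon.

(* By the sink hypothesis I(D) arises from I(C_n) by x_v |-> x_v^(w v), so both
   ideals are resolved by one scalar complex whose basis elements are labelled by
   sets of vertices: inserting the monomials x^(w . label) yields a graded complex,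
   which is exact as soon as the scalar complex restricted to the labels inside
   any given set of vertices is.  For n = 3q + 2, the Taylor complex is first cut
   down to the sets F of edges that contain no pair e_(3j), e_(3j+2); its strands
   are still cones, and now |label F| <= |F| + q + 1.  Cancelling unit entries
   makes the complex minimal without changing the Euler characteristic of its part
   with full label, which is -1.  Hence a basis element with full label survives in
   homological degree 2q + 1, and it maximises (weight of the label) - (degree)
   for every w.  Comparing two minimal resolutions shows that this maximum is the
   regularity. *)

Set Implicit Arguments.
Unset Strict Implicit.
Unset Printing Implicit Defensive.

Import GRing.Theory Num.Theory.

(** * Uniqueness of the regularity *)

Section HomogeneousMatrices.
Local Open Scope ring_scope.
Variables (n : nat) (k : fieldType).
Local Notation S := {mpoly k[n]}.

Definition homog_mx p q (dp : 'I_p -> nat) (dq : 'I_q -> nat)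
    (M : 'M[S]_(p, q)) : Prop :=
  forall a b m, m \in msupp (M a b) -> (mdeg m + dq b)%N = dp a.

(** The degree 0 component of a map of graded free modules. The test guards the truncated
    subtraction: an entry of negative degree has to be 0. *)
Definition homog_part p q (dp : 'I_p -> nat) (dq : 'I_q -> nat)
    (M : 'M[S]_(p, q)) : 'M[S]_(p, q) :=
  \matrix_(a, b) if (dq b <= dp a)%N then pihomog mdeg (dp a - dq b) (M a b)
                 else 0.

Lemma homog_part_homog p q (dp : 'I_p -> nat) (dq : 'I_q -> nat) M :
  homog_mx dp dq (homog_part dp dq M).
Proof.
move=> a b m; rewrite mxE; case: ifP => le_ba; last by rewrite msupp0.
have /dhomogP hom := @pihomogP n k mdeg (dp a - dq b) (M a b).
by move=> /hom ->; rewrite subnK.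
Qed.

Lemma homog_part_id p q (dp : 'I_p -> nat) (dq : 'I_q -> nat) M :
  homog_mx dp dq M -> homog_part dp dq M = M.
Proof.
move=> hom; apply/matrixP => a b; rewrite mxE.
have [->|nz] := eqVneq (M a b) 0; first by rewrite raddf0; case: ifP.
have [m mM] : exists m, m \in msupp (M a b).
  by exists (mlead (M a b)); rewrite mlead_supp.
rewrite -(hom _ _ _ mM) leq_addl addnK pihomog_dE //.
apply/dhomogP => m' m'M; apply/eqP.
by rewrite -(eqn_add2r (dq b)) (hom _ _ _ mM) (hom _ _ _ m'M).
Qed.

(** Expand [p] into monomials: multiplication by [q] shifts each of their degrees by [e]. *)
Lemma pihomogM d e (p q : S) : q \is e.-homog ->
  pihomog mdeg d (p * q) = if (e <= d)%N then pihomog mdeg (d - e) p * q else 0.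
Proof.
move=> hq; rewrite [in LHS](mpolyE p) mulr_suml raddf_sum /=.
rewrite pihomogE mulr_suml.
transitivity (\sum_(m <- msupp p)
   if (mdeg m + e == d)%N then p@_m *: 'X_[m] * q else 0 : S).
  apply: eq_bigr => m _; rewrite -scalerAl linearZ /=.
  have hmq : 'X_[m] * q \is (mdeg m + e).-homog.
    by apply: dhomogM => //; rewrite dhomogX.
  case: eqP => [<-|/eqP ne]; first by rewrite pihomog_dE.
  by rewrite (pihomog_ne0 ne) // scaler0.
rewrite -big_mkcond /=; case: leqP => [le_ed|lt_de].
  by apply: eq_bigl => m; rewrite -{1}(subnK le_ed) eqn_add2r.
by apply: big_pred0 => m; apply/negbTE; rewrite neq_ltn (ltn_addl _ lt_de) orbT.
Qed.

(** This makes lifts graded: in an equation [M *m N = A] with [N] and [A] homogeneous, [M] may be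
    replaced by its degree 0 component. *)
Lemma homog_part_mulr p q r (dp : 'I_p -> nat) (dq : 'I_q -> nat)
    (dr : 'I_r -> nat) M N :
  homog_mx dq dr N -> homog_part dp dr (M *m N) = homog_part dp dq M *m N.
Proof.
move=> hom; apply/matrixP => a c; rewrite [LHS]mxE [RHS]mxE mxE.
transitivity (\sum_b if (dr c <= dp a)%N then
   pihomog mdeg (dp a - dr c) (M a b * N b c) else 0).
  by case: ifP => _; [rewrite raddf_sum | rewrite big1].
apply: eq_bigr => b _; rewrite mxE.
have [->|nz] := eqVneq (N b c) 0; first by rewrite !mulr0 raddf0; case: ifP.
have [m mN] : exists m, m \in msupp (N b c).
  by exists (mlead (N b c)); rewrite mlead_supp.
have hm := hom _ _ _ mN.
have hN : N b c \is (mdeg m).-homog.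
  apply/dhomogP => m' m'M; apply/eqP.
  by rewrite -(eqn_add2r (dr c)) hm (hom _ _ _ m'M).
rewrite (pihomogM _ _ hN) -hm.
case: (leqP (dr c) (dp a)) => [le1|lt1].
  rewrite leq_subRL // -subnDA [(dr c + _)%N]addnC.
  by case: ifP; rewrite ?mul0r.
by rewrite leqNgt (leq_trans lt1) ?leq_addl // mul0r.
Qed.

Lemma homog_mxM p q r (dp : 'I_p -> nat) (dq : 'I_q -> nat)
    (dr : 'I_r -> nat) M N :
  homog_mx dp dq M -> homog_mx dq dr N -> homog_mx dp dr (M *m N).
Proof.
move=> hM hN; rewrite -(homog_part_id hM) -(homog_part_mulr _ _ hN).
exact: homog_part_homog.
Qed.

End HomogeneousMatrices.

(** * Comparison maps and homotopies between graded free resolutions *)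

Section Comparison.
Local Open Scope ring_scope.
Variables (n : nat) (k : fieldType).
Local Notation S := {mpoly k[n]}.
Local Notation cst M := (map_mx (mcoeff 0%MM) M).

(** Free modules are projective: the images of the basis elements are lifted one by one. *)
Lemma rows_choice p q r (A : 'M[S]_(p, r)) (B : 'M[S]_(q, r)) :
  (forall a, exists u, row a A = u *m B) -> exists M, M *m B = A.
Proof.
move=> /fin_all_exists [u hu]; exists (\matrix_a u a).
by apply/row_matrixP => a; rewrite row_mul rowK -hu.
Qed.

Section Lifting.
Variables (I : S -> Prop) (F G : free_complex n k).
Hypotheses (grF : graded F) (resF : resolves I F).
Hypotheses (grG : graded G) (resG : resolves I G).

Lemma diffK (H : free_complex n k) i :
  resolves I H -> fdiff H i.+1 *m fdiff H i = 0.
Proof.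
case=> _ _ ex; apply/row_matrixP => a; rewrite row_mul row0.
by apply/ex; exists (delta_mx 0 a); rewrite rowE.
Qed.

Lemma diff_augK (H : free_complex n k) :
  resolves I H -> fdiff H 0 *m faug H = 0.
Proof.
case=> _ ex _; apply/row_matrixP => a; rewrite row_mul row0.
by apply/ex; exists (delta_mx 0 a); rewrite rowE.
Qed.

Lemma lift_aug : exists M : 'M_(frank F 0, frank G 0),
  homog_mx (@fdeg _ _ F 0) (@fdeg _ _ G 0) M /\ M *m faug G = faug F.
Proof.
have [M hM] : exists M, M *m faug G = faug F.
  apply: rows_choice => a; case: resF resG => IF _ _ [IG _ _].
  have : I (faug F a 0).
    by apply/IF; exists (delta_mx 0 a); rewrite -rowE mxE.
  by move=> /IG [v hv]; exists v; apply/rowP => j; rewrite ord1 hv mxE.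
have homaug (H : free_complex n k) : graded H ->
    homog_mx (@fdeg _ _ H 0) (fun=> 0%N) (faug H).
  by move=> [h _] a b m; rewrite ord1 addn0; have /dhomogP := h a; apply.
exists (homog_part (@fdeg _ _ F 0) (@fdeg _ _ G 0) M).
split; first exact: homog_part_homog.
by rewrite -(homog_part_mulr _ _ (homaug _ grG)) hM homog_part_id //; apply: homaug.
Qed.

Lemma lift_step0 (M : 'M_(frank F 0, frank G 0)) :
  homog_mx (@fdeg _ _ F 0) (@fdeg _ _ G 0) M -> M *m faug G = faug F ->
  exists M' : 'M_(frank F 1, frank G 1),
  homog_mx (@fdeg _ _ F 1) (@fdeg _ _ G 1) M' /\
  M' *m fdiff G 0 = fdiff F 0 *m M.
Proof.
move=> homM hM; case: (resG) => _ ex _; case: (grF) (grG) => _ gF [_ gG].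
have [M' hM'] : exists M', M' *m fdiff G 0 = fdiff F 0 *m M.
  apply: rows_choice => a; apply/ex.
  by rewrite -row_mul -mulmxA hM (diff_augK resF) row0.
exists (homog_part (@fdeg _ _ F 1) (@fdeg _ _ G 1) M').
split; first exact: homog_part_homog.
have hG : homog_mx (@fdeg _ _ G 1) (@fdeg _ _ G 0) (fdiff G 0) by exact: gG.
have hF : homog_mx (@fdeg _ _ F 1) (@fdeg _ _ F 0) (fdiff F 0) by exact: gF.
by rewrite -(homog_part_mulr _ _ hG) hM' homog_part_id //; apply: homog_mxM hF _.
Qed.

Lemma lift_step i (M : 'M_(frank F i, frank G i))
    (M' : 'M_(frank F i.+1, frank G i.+1)) :
  homog_mx (@fdeg _ _ F i.+1) (@fdeg _ _ G i.+1) M' ->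
  M' *m fdiff G i = fdiff F i *m M ->
  exists M'' : 'M_(frank F i.+2, frank G i.+2),
  homog_mx (@fdeg _ _ F i.+2) (@fdeg _ _ G i.+2) M'' /\
  M'' *m fdiff G i.+1 = fdiff F i.+1 *m M'.
Proof.
move=> homM hM; case: (resG) => _ _ ex; case: (grF) (grG) => _ gF [_ gG].
have [M'' hM''] : exists M'', M'' *m fdiff G i.+1 = fdiff F i.+1 *m M'.
  apply: rows_choice => a; apply/ex.
  by rewrite -row_mul -mulmxA hM mulmxA (diffK _ resF) mul0mx row0.
exists (homog_part (@fdeg _ _ F i.+2) (@fdeg _ _ G i.+2) M'').
split; first exact: homog_part_homog.
have hG : homog_mx (@fdeg _ _ G i.+2) (@fdeg _ _ G i.+1) (fdiff G i.+1) by exact: gG.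
have hF : homog_mx (@fdeg _ _ F i.+2) (@fdeg _ _ F i.+1) (fdiff F i.+1) by exact: gF.
by rewrite -(homog_part_mulr _ _ hG) hM'' homog_part_id //; apply: homog_mxM hF _.
Qed.

Let lifts0 (M : 'M_(frank F 0, frank G 0)) : Prop :=
  homog_mx (@fdeg _ _ F 0) (@fdeg _ _ G 0) M /\ M *m faug G = faug F.

Let lifts i (M : 'M_(frank F i, frank G i))
    (M' : 'M_(frank F i.+1, frank G i.+1)) : Prop :=
  homog_mx (@fdeg _ _ F i.+1) (@fdeg _ _ G i.+1) M' /\
  M' *m fdiff G i = fdiff F i *m M.

(** Each lift depends on the previous one, so the chain map is chosen by recursion; that the choices
    succeed is proved afterwards, by induction. *)
Fixpoint lift_chain i : 'M[S]_(frank F i, frank G i) :=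
  match i with
  | 0 => epsilon (inhabits 0) lifts0
  | j.+1 => epsilon (inhabits 0) (lifts (lift_chain j))
  end.

Lemma lift_chain0 :
  homog_mx (@fdeg _ _ F 0) (@fdeg _ _ G 0) (lift_chain 0) /\
  lift_chain 0 *m faug G = faug F.
Proof. exact: (epsilon_spec _ lifts0 lift_aug). Qed.

Lemma lift_chainS i :
  homog_mx (@fdeg _ _ F i.+1) (@fdeg _ _ G i.+1) (lift_chain i.+1) /\
  lift_chain i.+1 *m fdiff G i = fdiff F i *m lift_chain i.
Proof.
elim: i => [|i [homM hM]]; apply: (epsilon_spec _ (lifts _)).
  by apply: lift_step0; case: lift_chain0.
exact: lift_step homM hM.
Qed.

Lemma lift_chain_homog i :
  homog_mx (@fdeg _ _ F i) (@fdeg _ _ G i) (lift_chain i).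
Proof. by case: i => [|i]; [case: lift_chain0 | case: (lift_chainS i)]. Qed.

End Lifting.

Section NullHomotopy.
Variables (I : S -> Prop) (F : free_complex n k).
Hypothesis resF : resolves I F.
Variable phi : forall i, 'M[S]_(frank F i).
Hypothesis phi0 : phi 0 *m faug F = 0.
Hypothesis phiS : forall i, phi i.+1 *m fdiff F i = fdiff F i *m phi i.

Let bounds i (Y : 'M_(frank F i)) (M : 'M_(frank F i, frank F i.+1)) : Prop :=
  M *m fdiff F i = Y.

(** The same kind of recursion: [phi j.+1] minus the part already accounted for is killed by the
    differential, hence is a boundary. *)
Fixpoint homotopy i : 'M[S]_(frank F i, frank F i.+1) :=
  match i with
  | 0 => epsilon (inhabits 0) (bounds (phi 0))
  | j.+1 => epsilon (inhabits 0)
              (bounds (phi j.+1 - fdiff F j *m homotopy j))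
  end.

Lemma homotopy0 : homotopy 0 *m fdiff F 0 = phi 0.
Proof.
apply: (epsilon_spec _ (bounds _)); apply: rows_choice => a.
by case: resF => _ ex _; apply/ex; rewrite -row_mul phi0 row0.
Qed.

Lemma homotopyS i :
  homotopy i.+1 *m fdiff F i.+1 = phi i.+1 - fdiff F i *m homotopy i.
Proof.
have [_ _ ex] := resF.
elim: i => [|i IHi]; apply: (epsilon_spec _ (bounds _)); apply: rows_choice => a;
  apply/ex; rewrite -row_mul mulmxBl phiS -mulmxA.
  by rewrite homotopy0 subrr row0.
by rewrite IHi mulmxBr mulmxA (diffK _ resF) mul0mx subr0 subrr row0.
Qed.

(** In positive degrees [phi] is a sum of two products, each with a differential as a factor (in
    degree 0, one such product). Taking constant terms is multiplicative and kills the differentials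
    of a minimal complex. *)
Lemma null_homotopic_cst i : minimal F -> cst (phi i) = 0.
Proof.
move=> minF; have cstd j : cst (fdiff F j) = 0.
  by apply/matrixP => a b; rewrite !mxE minF.
case: i => [|i]; first by rewrite -homotopy0 map_mxM cstd mulmx0.
by rewrite -[phi _](subrK (fdiff F i *m homotopy i)) -homotopyS map_mxD
  !map_mxM !cstd mulmx0 mul0mx addr0.
Qed.

End NullHomotopy.

(** The composite of the two comparison maps is homotopic to the identity, hence equal to it modulo
    the variables. So row [a] of the first map has a nonzero constant entry, and homogeneity gives
    its column the degree of [a]. *)
Lemma betti_le_transfer (I : S -> Prop) (F G : free_complex n k) i j :
  minimal_graded_resolution I F -> minimal_graded_resolution I G ->
  betti F i j != 0%N -> betti G i j != 0%N.
Proof.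
move=> [gF rF mF] [gG rG mG].
pose f := lift_chain F G; pose g := lift_chain G F.
pose phi l := f l *m g l - 1%:M.
have [_ f0] := lift_chain0 gF rF gG rG; have [_ g0] := lift_chain0 gG rG gF rF.
have phi0 : phi 0 *m faug F = 0.
  by rewrite mulmxBl mul1mx -mulmxA g0 f0 subrr.
have phiS l : phi l.+1 *m fdiff F l = fdiff F l *m phi l.
  have [_ fS] := lift_chainS gF rF gG rG l.
  have [_ gS] := lift_chainS gG rG gF rF l.
  by rewrite mulmxBl mulmxBr mul1mx mulmx1 -mulmxA gS !mulmxA fS.
have := null_homotopic_cst rF phi0 phiS i mF.
rewrite /phi map_mxB map_mxM map_mx1 => /eqP; rewrite subr_eq0 => /eqP fg1.
rewrite -lt0n => /card_gt0P [a]; rewrite inE => /eqP deg_a.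
have : (cst (f i) *m cst (g i)) a a != 0 by rewrite fg1 mxE eqxx oner_neq0.
rewrite mxE -lt0n => /eqP ne0.
have [b hb] : exists b, cst (f i) a b != 0.
  apply/existsP; apply: contraT; rewrite negb_exists => /forallP all0.
  case: ne0; apply: big1 => b _.
  by move: (all0 b); rewrite negbK => /eqP ->; rewrite mul0r.
apply/card_gt0P; exists b; rewrite inE -deg_a; apply/eqP.
move: hb; rewrite mxE -mcoeff_msupp => /(lift_chain_homog gF rF gG rG).
by rewrite mdeg0.
Qed.

Lemma is_reg_le (I : S -> Prop) r r' : is_reg I r -> is_reg I r' -> (r <= r')%N.
Proof.
move=> [F [resF [i nz] _]] [G [resG _ bound]].
by have /bound := betti_le_transfer resF resG nz; rewrite leq_add2r.
Qed.

Lemma reg_eq (I : S -> Prop) r : is_reg I r -> reg I = r.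
Proof.
move=> regI; apply/eqP; rewrite eqn_leq.
have regI' : is_reg I (reg I) by apply: epsilon_spec; exists r.
by rewrite !(is_reg_le regI' regI, is_reg_le regI regI').
Qed.

End Comparison.

(** * Labelled complexes and cancellation of units *)

Section LabelledComplexes.
Local Open Scope ring_scope.
Variables (k : fieldType) (n N : nat).
Variables (l : 'I_N -> {set 'I_n}) (h : 'I_N -> nat) (U : pred {set 'I_n}).

Definition in_strand (B : {set 'I_N}) (s : {set 'I_n}) (v : 'rV[k]_N) : Prop :=
  forall a, v 0 a != 0 -> (a \in B) && (l a \subset s).

(* [D] is the total differential, in all homological degrees at once, acting on
   row vectors; the condition [U s] says that [s] contains the label of a
   generator, and only such strands have to be exact. *)
Record labelled_resolution (B : {set 'I_N}) (D : 'M[k]_N) : Prop := {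
  labelled_entry : forall a b, D a b != 0 ->
    [/\ a \in B, b \in B, l b \subset l a & h a = (h b).+1];
  labelled_diffK : D *m D = 0;
  labelled_exact : forall s v, U s -> in_strand B s v -> v *m D = 0 ->
    exists2 u, in_strand B s u & v = u *m D
}.

(** Only labels equal to [s] count: a cancelled pair has equal labels and adjacent degrees, so this
    number is unchanged when units are cancelled. *)
Definition euler (B : {set 'I_N}) (s : {set 'I_n}) : int :=
  \sum_(a in B | l a == s) (-1) ^+ h a.

Lemma sum_neq0 (I : finType) (F : I -> k) :
  \sum_i F i != 0 -> exists i, F i != 0.
Proof.
move=> nz; apply/existsP; apply: contraNT nz; rewrite negb_exists.
by move=> /forallP all0; apply/eqP/big1 => i _; apply/eqP; rewrite -[_ == _]negbK.
Qed.

(** * Cancellation of a single unit entry *)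

Section Cancellation.
Variables (B : {set 'I_N}) (D : 'M[k]_N) (a b : 'I_N).
Hypothesis resD : labelled_resolution B D.
Hypotheses (Dab : D a b != 0) (lab : l a = l b).

(* [J] is a homotopy supported on the pair (a, b), so [pi] is an idempotent chain
   map homotopic to the identity; as [Q pi Q = Q] and [pi Q pi = pi], deleting the
   coordinates a and b identifies the image of [pi] with a complex on [B']. *)
Let J : 'M[k]_N := (D a b)^-1 *: delta_mx b a.
Let pi : 'M[k]_N := 1%:M - D *m J - J *m D.
Let Q : 'M[k]_N := 1%:M - delta_mx a a - delta_mx b b.
Let B' := B :\: [set a; b].
Let D' := Q *m D *m pi *m Q.

Let aB : a \in B. Proof. by case: (labelled_entry resD Dab). Qed.
Let bB : b \in B. Proof. by case: (labelled_entry resD Dab). Qed.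
Let hab : h a = (h b).+1. Proof. by case: (labelled_entry resD Dab). Qed.
Let neq_ab : (a == b) = false.
Proof. by apply/eqP => eab; move: hab; rewrite eab => /n_Sn. Qed.
Let neq_ba : (b == a) = false. Proof. by rewrite eq_sym neq_ab. Qed.

Let delta_mul p c d (M : 'M[k]_(N, p)) :
  (delta_mx c d : 'M[k]_N) *m M = \matrix_(i, j) ((i == c)%:R * M d j).
Proof.
apply/matrixP => i j; rewrite !mxE (bigD1 d) //= mxE eqxx andbT big1 ?addr0 //.
by move=> e /negbTE ne; rewrite mxE ne andbF mul0r.
Qed.

Let mul_delta p c d (M : 'M[k]_(p, N)) :
  M *m (delta_mx c d : 'M[k]_N) = \matrix_(i, j) (M i c * (j == d)%:R).
Proof.
apply/matrixP => i j; rewrite !mxE (bigD1 c) //= mxE eqxx /= big1 ?addr0 //.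
by move=> e /negbTE ne; rewrite mxE ne mulr0.
Qed.

Let JJ : J *m J = 0.
Proof.
rewrite /J -scalemxAl -scalemxAr delta_mul.
by apply/matrixP => i j; rewrite !mxE neq_ab /= !mulr0.
Qed.

Let JDJ : J *m D *m J = J.
Proof.
rewrite /J -scalemxAl -scalemxAr mul_delta delta_mul.
apply/matrixP => i j; rewrite !mxE; case: (i == b); case: (j == a);
  by rewrite /= ?(mul0r, mul1r, mulr0, mulr1) ?mulVf ?mulr1.
Qed.

Let pi_J : pi *m J = 0.
Proof.
by rewrite /pi !mulmxBl mul1mx JDJ -[D *m J *m J]mulmxA JJ mulmx0 subr0 subrr.
Qed.

Let J_pi : J *m pi = 0.
Proof. by rewrite /pi !mulmxBr mulmx1 !mulmxA JDJ JJ mul0mx subr0 subrr. Qed.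

Let pi_idem : pi *m pi = pi.
Proof.
have JDpi : J *m D *m pi = 0.
  rewrite /pi !mulmxBr mulmx1 !mulmxA -[J *m D *m D]mulmxA JDJ.
  by rewrite (labelled_diffK resD) mulmx0 mul0mx subr0 subrr.
by rewrite {1}/pi !mulmxBl mul1mx -[D *m J *m pi]mulmxA J_pi mulmx0 JDpi !subr0.
Qed.

Let D_pi : D *m pi = pi *m D.
Proof.
have DD := labelled_diffK resD.
rewrite /pi !mulmxBl !mulmxBr mul1mx mulmx1 !mulmxA DD mul0mx subr0.
by rewrite -[J *m D *m D]mulmxA DD mulmx0 subr0.
Qed.

Let QQ : Q *m Q = Q.
Proof.
rewrite {1}/Q !mulmxBl mul1mx /Q !mulmxBr !mulmx1 !mul_delta_mx.
by rewrite !mul_delta_mx_0 ?neq_ab ?neq_ba // !subr0 !subrr ?subr0 ?oppr0 ?addr0.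
Qed.

Let QpiQ : Q *m pi *m Q = Q.
Proof.
have QJ : Q *m J = 0.
  rewrite /J -scalemxAr /Q !mulmxBl mul1mx mul_delta_mx mul_delta_mx_0.
    by rewrite subr0 subrr scaler0.
  by rewrite neq_ab.
have JQ : J *m Q = 0.
  rewrite /J -scalemxAl /Q !mulmxBr mulmx1 mul_delta_mx mul_delta_mx_0.
    by rewrite subr0 subrr scaler0.
  by rewrite neq_ab.
have gen (R : 'M[k]_N) : R *m J = 0 -> J *m R = 0 -> R *m R = R ->
    R *m pi *m R = R.
  move=> RJ JR RR; rewrite /pi !mulmxBr !mulmxBl mulmx1 RR !mulmxA RJ.
  by rewrite -[R *m D *m J *m R]mulmxA JR mulmx0 !mul0mx !subr0.
exact: gen QJ JQ QQ.
Qed.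

Let piQpi : pi *m Q *m pi = pi.
Proof.
have pib : pi *m delta_mx b b = 0.
  have -> : delta_mx b b = D a b *: (J *m delta_mx a b).
    by rewrite /J -scalemxAl mul_delta_mx scalerA divff // scale1r.
  by rewrite -scalemxAr mulmxA pi_J mul0mx scaler0.
have api : delta_mx a a *m pi = 0.
  have -> : delta_mx a a = D a b *: (delta_mx a b *m J).
    by rewrite /J -scalemxAr mul_delta_mx scalerA divff // scale1r.
  by rewrite -scalemxAl -mulmxA J_pi mulmx0 scaler0.
have -> : pi *m Q = pi - pi *m delta_mx a a.
  by rewrite [pi *m Q]mulmxBr pib subr0 [LHS]mulmxBr mulmx1.
by rewrite [LHS]mulmxBl -[pi *m _ *m pi]mulmxA api mulmx0 subr0.
Qed.

(** Membership in [B] is an implication so that the identity matrix, which has nonzero entries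
    outside [B] too, qualifies. *)
Let preserves (M : 'M[k]_N) : Prop :=
  forall c d, M c d != 0 -> (c \in B -> d \in B) /\ l d \subset l c.

Let preserves1 : preserves 1%:M.
Proof. by move=> c d; rewrite mxE; case: (eqVneq c d) => [->|]; rewrite ?eqxx. Qed.

Let preservesB M M' : preserves M -> preserves M' -> preserves (M - M').
Proof.
move=> pM pM' c d; rewrite !mxE; have [->|nz _] := eqVneq (M c d) 0.
  by rewrite sub0r oppr_eq0 => /pM'.
exact: pM.
Qed.

Let preservesM M M' : preserves M -> preserves M' -> preserves (M *m M').
Proof.
move=> pM pM' c d; rewrite mxE => /sum_neq0 [e].
rewrite mulf_eq0 negb_or => /andP [/pM [cB le] /pM' [eB ld]].
by split; [move=> /cB /eB | apply: subset_trans ld le].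
Qed.

Let preservesD : preserves D.
Proof. by move=> c d /(labelled_entry resD) []. Qed.

(** [J] leads from [b] back to [a], against the direction of [D]; the label does not grow because
    the two labels agree. *)
Let preservesJ : preserves J.
Proof.
move=> c d; rewrite !mxE; case: (eqVneq c b) => [->|_]; last by rewrite mulr0 eqxx.
by case: (eqVneq d a) => [->|_]; rewrite ?lab // mulr0 eqxx.
Qed.

Let preservesPi : preserves pi.
Proof. by do 2?[apply: preservesB => //]; apply: preservesM. Qed.

Let strandM s v M : preserves M -> in_strand B s v -> in_strand B s (v *m M).
Proof.
move=> pM vs d; rewrite mxE => /sum_neq0 [c]; rewrite mulf_eq0 negb_or.
case/andP => /vs /andP [cB ls] /pM [dB ld].
by rewrite dB // (subset_trans ld ls).
Qed.

Let entryQ p (v : 'M[k]_(p, N)) i c :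
  (v *m Q) i c = if c \in [set a; b] then 0 else v i c.
Proof.
rewrite /Q !mulmxBr mulmx1 !mul_delta !mxE !inE.
have [->|_] := eqVneq c a; first by rewrite neq_ab /= mulr1 mulr0 subrr subr0.
have [->|_] := eqVneq c b; first by rewrite mulr1 mulr0 subr0 subrr.
by rewrite !mulr0 !subr0.
Qed.

Let entryQl p (v : 'M[k]_(N, p)) c i :
  (Q *m v) c i = if c \in [set a; b] then 0 else v c i.
Proof.
rewrite /Q !mulmxBl mul1mx !delta_mul !mxE !inE.
have [->|_] := eqVneq c a; first by rewrite neq_ab /= mul1r mul0r subrr subr0.
have [->|_] := eqVneq c b; first by rewrite mul1r mul0r subr0 subrr.
by rewrite !mul0r !subr0.
Qed.

Let strandQ s v : in_strand B s v -> in_strand B' s (v *m Q).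
Proof.
by move=> vs c; rewrite entryQ in_setD; case: ifP; rewrite ?eqxx //= => _ /vs.
Qed.

Let strandQ_id s v : in_strand B' s v -> v *m Q = v.
Proof.
move=> vs; apply/rowP => c; rewrite entryQ; case: ifP => // cab.
apply/esym/eqP; apply: contraT => /vs.
by rewrite in_setD cab.
Qed.

(** The Schur complement: entry [(c, d)] becomes [D c d - D c b * (D a b)^-1 * D a d], from which
    labels and degrees can be read off. *)
Let D'E : D' = Q *m (D - D *m J *m D) *m Q.
Proof.
rewrite /D' -[Q *m D *m pi]mulmxA; congr (_ *m _ *m _).
by rewrite /pi !mulmxBr mulmx1 !mulmxA (labelled_diffK resD) mul0mx subr0.
Qed.

(** Since [pi] commutes with [D] and [pi Q pi = pi], the square collapses to [Q D D pi Q]. *)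
Let D'D' : D' *m D' = 0.
Proof.
rewrite /D' !mulmxA -[Q *m D *m pi *m Q *m Q]mulmxA QQ.
rewrite -[_ *m D *m pi in LHS]mulmxA D_pi -!mulmxA [Q *m (pi *m _)]mulmxA.
rewrite [pi *m (Q *m pi *m _)]mulmxA [pi *m (Q *m pi)]mulmxA piQpi.
by rewrite [pi *m (D *m Q)]mulmxA -D_pi !mulmxA -[Q *m D *m D]mulmxA
  (labelled_diffK resD) mulmx0 !mul0mx.
Qed.

Lemma cancel_resolution : labelled_resolution B' D'.
Proof.
split=> //.
- move=> c d; rewrite D'E entryQ; case: ifP => [|dn]; first by rewrite eqxx.
  rewrite entryQl; case: ifP => [|cn]; first by rewrite eqxx.
  rewrite !in_setD cn dn /= !mxE.
  have -> : (\sum_j (D *m J) c j * D j d) = D c b * (D a b)^-1 * D a d.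
    rewrite (bigD1 a) //= /J -scalemxAr mul_delta big1 => [|e /negbTE ne].
      by rewrite !mxE eqxx mulr1 addr0 [_^-1 * _]mulrC.
    by rewrite !mxE ne !mulr0 mul0r.
  have [Dcd|nz _] := eqVneq (D c d) 0; last exact: (labelled_entry resD nz).
  rewrite Dcd sub0r oppr_eq0 !mulf_eq0 !negb_or => /andP [/andP [Dcb _] Dad].
  have [cB _ lbc hcb] := labelled_entry resD Dcb.
  have [_ dB lda had] := labelled_entry resD Dad.
  rewrite cB dB (subset_trans lda) ?lab //; split=> //.
  by rewrite hcb; congr _.+1; apply: succn_inj; rewrite -had hab.
- move=> s v Us vs vD'.
  have vQ := strandQ_id vs.
  have vB : in_strand B s v by move=> c /vs /andP [/setDP [-> _] ->].
  (* With [v = v Q] and [pi = pi Q pi] this product is [(v D') pi]; hence [v pi] is a cycle of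
     [D]. *)
  have vDpi : v *m D *m pi = 0.
    rewrite -piQpi !mulmxA -[RHS](mul0mx _ pi) -vD' /D'.
    by rewrite -[in LHS]vQ !mulmxA.
  have [|y ys uE] := @labelled_exact _ _ resD s (v *m pi) Us (strandM preservesPi vB).
    by rewrite -mulmxA -D_pi mulmxA.
  exists (y *m pi *m Q); first by apply: strandQ; apply: strandM.
  have uQ : v *m pi *m Q = v by rewrite -[in LHS]vQ -!mulmxA [Q *m _]mulmxA QpiQ vQ.
  have upi : v *m pi *m pi = v *m pi by rewrite -mulmxA pi_idem.
  (* With [R = pi], the boundary of [y R Q] is [y R Q D R Q = y R D Q = y D R Q = v R R Q = v]. *)
  have gen (R : 'M[k]_N) : R *m R = R -> R *m Q *m R = R -> D *m R = R *m D ->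
      v *m R *m R = v *m R -> v *m R *m Q = v -> v *m R = y *m D ->
      v = y *m R *m Q *m (Q *m D *m R *m Q).
    move=> RR RQR DR vRR vRQ yE; rewrite -[Q *m D *m R]mulmxA DR -!mulmxA.
    rewrite [Q *m (Q *m _)]mulmxA QQ [Q *m (R *m _)]mulmxA [R *m (_ *m _)]mulmxA.
    rewrite [R *m (Q *m R)]mulmxA RQR [R *m (_ *m _)]mulmxA -DR !mulmxA -yE.
    by rewrite vRR vRQ.
  exact: gen pi_idem piQpi D_pi upi uQ uE.
Qed.

Lemma cancel_euler s : euler B' s = euler B s.
Proof.
rewrite /euler; have [las|las] := eqVneq (l a) s.
  have lbs : l b == s by rewrite -lab las.
  rewrite [RHS](bigD1 a) /= ?aB ?las ?eqxx // [X in _ + X](bigD1 b) /=; last first.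
    by rewrite bB lbs neq_ba.
  rewrite addrA hab exprS mulN1r addNr add0r; apply: eq_bigl => c.
  by rewrite !inE; case: (c == a); case: (c == b); rewrite ?andbT ?andbF //= ?andbF.
apply: eq_bigl => c; rewrite !inE; case: (eqVneq c a) => [->|_] /=.
  by rewrite (negbTE las) andbF.
by case: (eqVneq c b) => [->|_] //=; rewrite -lab (negbTE las) andbF.
Qed.

End Cancellation.

(** Every cancellation shrinks [B], so the process ends, with no nonzero entry left between equal
    labels. Such entries are the ones that would become nonzero constants after homogenization. *)
Lemma minimalize_resolution B D : labelled_resolution B D ->
  exists B' D', [/\ labelled_resolution B' D', B' \subset B,
    forall a b, D' a b != 0 -> l a != l b & forall s, euler B' s = euler B s].
Proof.
have [m] := ubnP #|B|; elim: m B D => // m IHm B D; rewrite ltnS => leBm resD.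
case: (pickP (fun ab : 'I_N * 'I_N => (D ab.1 ab.2 != 0) && (l ab.1 == l ab.2))).
  move=> [a b] /= /andP [Dab /eqP lab].
  have [aB _ _ _] := labelled_entry resD Dab.
  have [|B1 [D1 [res1 sub1 min1 eul1]]] := IHm _ _ _ (cancel_resolution resD Dab lab).
    apply: leq_trans leBm; apply/proper_card/properP; split; first exact: subsetDl.
    by exists a; rewrite // !inE eqxx.
  exists B1, D1; split=> // [|s]; first exact: subset_trans sub1 (subsetDl _ _).
  by rewrite eul1 (cancel_euler resD Dab lab).
move=> none; exists B, D; split=> // a b Dab.
by have := none (a, b); rewrite /= Dab => /= ->.
Qed.

End LabelledComplexes.

(** * Subcomplexes of the Taylor complex *)

Section TaylorSubcomplex.
Local Open Scope ring_scope.
Variables (k : fieldType) (n m : nat) (lam : 'I_m -> {set 'I_n}).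
Variable Delta : pred {set 'I_m}.

Local Notation N := #|{: {set 'I_m}}|.
Implicit Types (F G : {set 'I_m}) (e f : 'I_m).

Definition face (a : 'I_N) : {set 'I_m} := enum_val a.

(** The combinatorial form of the least common multiple of the generators in [F]. *)
Definition flabel F : {set 'I_n} := \bigcup_(e in F) lam e.

Let bv F : 'rV[k]_N := delta_mx 0 (enum_rank F).

Definition sgn e F : k := (-1) ^+ #|[set x in F | (x < e)%N]|.

Definition del e : 'M[k]_N :=
  \matrix_a (if e \in face a then sgn e (face a) *: bv (face a :\ e) else 0).

(* The contracting homotopy of a simplicial cone with apex e. *)
Definition ins e : 'M[k]_N :=
  \matrix_a (if e \in face a then 0 else sgn e (face a) *: bv (e |: face a)).

Let bv_row F (M : 'M[k]_N) : bv F *m M = row (enum_rank F) M.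
Proof. by rewrite rowE. Qed.

Let bvP (M M' : 'M[k]_N) : (forall F, bv F *m M = bv F *m M') -> M = M'.
Proof.
move=> eqM; apply/row_matrixP => a.
by have := eqM (enum_val a); rewrite !bv_row enum_valK.
Qed.

Let bv_del F e : bv F *m del e = if e \in F then sgn e F *: bv (F :\ e) else 0.
Proof. by rewrite bv_row rowK /face enum_rankK. Qed.

Let bv_ins F e : bv F *m ins e = if e \in F then 0 else sgn e F *: bv (e |: F).
Proof. by rewrite bv_row rowK /face enum_rankK. Qed.

Lemma sgn_sq e F : sgn e F * sgn e F = 1.
Proof. by rewrite /sgn -exprMn mulrNN mulr1 expr1n. Qed.

Lemma sgnD1 e f F : f \in F ->
  sgn e (F :\ f) = if (f < e)%N then - sgn e F else sgn e F.
Proof.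
move=> fF; rewrite /sgn; case: ifP => lt_fe.
  rewrite [in RHS](cardsD1 f) !inE fF lt_fe exprS mulN1r opprK; congr (_ ^+ _).
  by apply: eq_card => x; rewrite !inE andbA.
congr (_ ^+ _); apply: eq_card => x; rewrite !inE.
by case: eqVneq => [->|]; rewrite ?lt_fe ?andbF.
Qed.

Lemma sgnU1 e f F : f \notin F ->
  sgn e (f |: F) = if (f < e)%N then - sgn e F else sgn e F.
Proof.
move=> fF; have := sgnD1 e (setU11 f F); rewrite !setU1K // => ->.
by case: (f < e)%N; rewrite ?opprK.
Qed.

Lemma del_del e : del e *m del e = 0.
Proof.
apply: bvP => F; rewrite mulmx0 mulmxA bv_del; case: ifP => eF; last by rewrite mul0mx.
by rewrite -scalemxAl bv_del !inE eqxx scaler0.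
Qed.

Lemma del_anticomm e f : e != f -> del e *m del f = - (del f *m del e).
Proof.
move=> ne_ef; apply: bvP => F; rewrite mulmxN !mulmxA !bv_del.
case: ifP => eF; case: ifP => fF; rewrite ?mul0mx ?oppr0 //=; last 2 first.
- by rewrite -scalemxAl bv_del !inE fF andbF scaler0.
- by rewrite -scalemxAl bv_del !inE eF andbF scaler0 oppr0.
rewrite -!scalemxAl !bv_del !inE eF fF ne_ef eq_sym ne_ef /= !scalerA.
rewrite !sgnD1 // -scaleNr; have -> : F :\ e :\ f = F :\ f :\ e.
  by apply/setP => x; rewrite !inE andbCA.
congr (_ *: _); case: (ltngtP e f) => [lt_ef|lt_fe|/val_inj eq_ef].
- by rewrite mulrN mulrC.
- by rewrite mulrN opprK mulrC.
- by rewrite eq_ef eqxx in ne_ef.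
Qed.

Lemma ins_del_anticomm e f : e != f -> ins e *m del f = - (del f *m ins e).
Proof.
move=> ne_ef; apply: bvP => F; rewrite mulmxN !mulmxA bv_del bv_ins.
case: ifP => eF; case: ifP => fF; rewrite ?mul0mx ?oppr0 //=.
- by rewrite -scalemxAl bv_ins !inE eF ne_ef scaler0 oppr0.
- rewrite -!scalemxAl bv_del bv_ins !inE eF fF ne_ef eq_sym (negbTE ne_ef) /=.
  rewrite !scalerA sgnD1 // sgnU1 ?eF // -scaleNr.
  have -> : (e |: F) :\ f = e |: (F :\ f).
    apply/setP => x; rewrite !inE; case: (eqVneq x e) => [->|] //=.
    by rewrite ne_ef.
  congr (_ *: _); case: (ltngtP e f) => [lt_ef|lt_fe|/val_inj eq_ef].
  + by rewrite mulrN mulrC.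
  + by rewrite mulrN opprK mulrC.
  + by rewrite eq_ef eqxx in ne_ef.
- by rewrite -scalemxAl bv_del !inE fF eq_sym (negbTE ne_ef) scaler0.
Qed.

Lemma ins_del e : ins e *m del e + del e *m ins e = 1%:M.
Proof.
apply: bvP => F; rewrite mulmxDr !mulmxA bv_del bv_ins mulmx1.
case: ifP => eF; rewrite mul0mx ?add0r ?addr0 -scalemxAl.
  rewrite bv_ins !inE eqxx /= scalerA sgnD1 // ltnn sgn_sq scale1r.
  by rewrite setD1K.
by rewrite bv_del setU11 scalerA sgnU1 ?eF // ltnn sgn_sq scale1r setU1K ?eF.
Qed.

(** The pairs [(e, f)] and [(f, e)] cancel. The diagonal is a separate hypothesis because
    antisymmetry says nothing about it in characteristic 2. *)
Lemma alternating_sum0 (V : zmodType) (A : 'I_m -> 'I_m -> V) :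
  (forall e, A e e = 0) -> (forall e f, e != f -> A e f = - A f e) ->
  \sum_e \sum_f A e f = 0.
Proof.
move=> A0 AN.
transitivity (\sum_(e < m) (\sum_(f < m | (f < e)%N) A e f +
                             \sum_(f < m | (e < f)%N) A e f)).
  apply: eq_bigr => e _; rewrite (bigID (fun f : 'I_m => (f < e)%N)) /=; congr (_ + _).
  rewrite (bigD1 e) /= ?ltnn // A0 add0r; apply: eq_bigl => f.
  by rewrite -leqNgt [RHS]ltn_neqAle andbC eq_sym.
rewrite big_split /= [X in _ + X](exchange_big_dep xpredT) //= -big_split /=.
apply: big1 => e _; rewrite -big_split /= big1 // => f lt_fe.
by rewrite AN ?addNr // neq_ltn lt_fe orbT.
Qed.

Let D0 : 'M[k]_N := \sum_e del e.

Let D0D0 : D0 *m D0 = 0.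
Proof.
rewrite /D0 mulmx_suml; under eq_bigr do rewrite mulmx_sumr.
by apply: alternating_sum0; [apply: del_del | apply: del_anticomm].
Qed.

(** Only the summand [del e] of the differential contributes; [ins e] anticommutes with all the
    others. *)
Let ins_D0 e : ins e *m D0 + D0 *m ins e = 1%:M.
Proof.
rewrite /D0 mulmx_suml mulmx_sumr -big_split /= (bigD1 e) //= ins_del.
rewrite big1 ?addr0 // => f; rewrite eq_sym => ne_ef.
by rewrite ins_del_anticomm // addNr.
Qed.

Let bv0E F a : bv F 0 a = (face a == F)%:R.
Proof. by rewrite mxE eqxx /= -(inj_eq enum_val_inj) enum_rankK. Qed.

Let D0_entry a b : D0 a b != 0 -> exists2 e, e \in face a & face b = face a :\ e.
Proof.
rewrite summxE => /sum_neq0 [e]; rewrite mxE; case: ifP => eF; last by rewrite mxE eqxx.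
rewrite mxE bv0E; case: (eqVneq (face b) (face a :\ e)) => [->|_].
  by exists e.
by rewrite mulr0 eqxx.
Qed.

Lemma flabelS F G : F \subset G -> flabel F \subset flabel G.
Proof.
move=> /subsetP sFG; apply/bigcupsP => e /sFG eG; exact: (bigcup_sup e).
Qed.

Definition taylor_faces : {set 'I_N} := [set a | Delta (face a)].

(** Clearing the rows outside [Delta] is enough: once [Delta] is closed under subsets, the other
    rows only involve faces in [Delta]. *)
Definition taylor_diff : 'M[k]_N :=
  \matrix_(a, b) if Delta (face a) then (\sum_e del e) a b else 0.

Hypothesis Delta_sub : forall F G, G \subset F -> Delta F -> Delta G.

Definition has_generator (s : {set 'I_n}) : bool := [exists e, lam e \subset s].

(** Each strand that contains a generator is a simplicial cone, with an apex that may depend on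
    [s]. *)
Hypothesis Delta_cone : forall s, has_generator s -> exists2 e, lam e \subset s &
  forall F, Delta F -> flabel F \subset s -> Delta (e |: F).

Let taylor_entry a b : taylor_diff a b != 0 -> Delta (face a) /\ D0 a b != 0.
Proof. by rewrite mxE; case: ifP; rewrite ?eqxx. Qed.

Let taylor_strand s v : in_strand (fun a => flabel (face a)) taylor_faces s v ->
  v *m taylor_diff = v *m D0.
Proof.
move=> vs; apply/rowP => b; rewrite !mxE; apply: eq_bigr => a _.
have [->|/vs] := eqVneq (v 0 a) 0; first by rewrite !mul0r.
by rewrite inE mxE => /andP [-> _].
Qed.

(** Inserting the apex [e] stays inside the strand and contracts it, so a cycle [v] is the boundary
    of [v *m ins e]. *)
Lemma taylor_resolution : labelled_resolution (fun a => flabel (face a))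
  (fun a => #|face a|) has_generator taylor_faces taylor_diff.
Proof.
split.
- move=> a b /taylor_entry [Da] /D0_entry [e ea fb]; rewrite !inE Da.
  have sub : face b \subset face a by rewrite fb subsetDl.
  rewrite (Delta_sub sub Da) (flabelS sub); split=> //.
  by rewrite fb [LHS](cardsD1 e) ea.
- apply/row_matrixP => a; rewrite row_mul row0.
  rewrite (taylor_strand (s := setT)) => [|b].
    apply/rowP => b; rewrite mxE [RHS]mxE.
    case Da: (Delta (face a)); last first.
      by apply: big1 => c _; rewrite !mxE Da mul0r.
    have := congr1 (fun M : 'M_N => M a b) D0D0; rewrite !mxE => D0ab.
    by rewrite -[RHS]D0ab; apply: eq_bigr => c _; rewrite !mxE Da.
  rewrite mxE => /taylor_entry [Da] /D0_entry [e ea fb].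
  by rewrite inE subsetT (Delta_sub _ Da) // fb subsetDl.
- move=> s v Us vs vD; have [e es cone] := Delta_cone Us.
  have us : in_strand (fun a => flabel (face a)) taylor_faces s (v *m ins e).
    move=> b; rewrite mxE => /sum_neq0 [a]; rewrite mulf_eq0 negb_or.
    case/andP => /vs; rewrite !inE => /andP [Da sa].
    rewrite mxE; case: ifP => ea; first by rewrite mxE eqxx.
    rewrite mxE bv0E; case: (eqVneq (face b) (e |: face a)) => [->|_]; last first.
      by rewrite mulr0 eqxx.
    by rewrite cone //= /flabel big_setU1 ?ea //= subUset es sa.
  exists (v *m ins e) => //; rewrite (taylor_strand us).
  have vD0 : v *m D0 = 0 by rewrite -(taylor_strand vs).
  by rewrite -[LHS]mulmx1 -(ins_D0 e) mulmxDr !mulmxA vD0 mul0mx addr0.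
Qed.

Lemma taylor_euler s :
  euler (fun a => flabel (face a)) (fun a => #|face a|) taylor_faces s
  = \sum_(F | Delta F && (flabel F == s)) (-1) ^+ #|F|.
Proof.
have bij : bijective face.
  by exists enum_rank => [a|F]; [apply: enum_valK | apply: enum_rankK].
rewrite /euler [RHS](reindex face) /=; last exact: onW_bij.
by apply: eq_bigl => a; rewrite inE.
Qed.

End TaylorSubcomplex.

(** * The complex of a cycle *)

(** Toggling [e] is a sign-reversing involution on the sets that satisfy [P]. *)
Lemma toggle_sum0 (T : finType) (P : pred {set T}) (e : T) :
  (forall F : {set T}, e \notin F -> P (e |: F) = P F) ->
  (\sum_(F : {set T} | P F) (-1) ^+ #|F| = 0 :> int)%R.
Proof.
move=> Pe; rewrite (bigID (fun F : {set T} => e \in F)) /=.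
rewrite (reindex_onto (fun F => e |: F) (fun F => F :\ e)) /=; last first.
  by move=> F /andP [_ eF]; rewrite setD1K.
rewrite (eq_bigl (fun F : {set T} => P F && (e \notin F))) => [|F]; last first.
  have [eF|eF] := boolP (e \in F).
    rewrite andbF; apply/andP => -[_ /eqP eqF].
    by have := setD11 e (e |: F); rewrite eqF eF.
  by rewrite setU11 setU1K // eqxx !andbT Pe.
rewrite -big_split big1 //= => F /andP [_ eF].
by rewrite cardsU1 eF exprS mulN1r addNr.
Qed.

Section CycleComplex.
Variable q : nat.
Local Notation n := (3 * q).+2.
Implicit Types (F G : {set 'I_n}) (e f x : 'I_n).

Definition cycle_edge e : {set 'I_n} := [set e; ordS e].

(* As 3q + 2 is not an edge, the last group consists of e_(3q) and e_(3q + 1) only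
   and carries no condition. *)
Definition cycle_faces F : bool :=
  [forall e in F, forall f in F, ~~ ((3 %| e) && (f == e.+2 :> nat))].

Lemma cycle_facesP F : reflect
  (forall e f, e \in F -> f \in F -> 3 %| e -> f = e.+2 :> nat -> False)
  (cycle_faces F).
Proof.
apply: (iffP forall_inP) => [H e f eF fF e3 ef|H e eF].
  by have /forall_inP /(_ f fF) := H e eF; rewrite e3 ef eqxx.
apply/forall_inP => f fF; apply/negP => /andP [e3 /eqP ef].
exact: H eF fF e3 ef.
Qed.

Lemma cycle_faces_sub F G : G \subset F -> cycle_faces F -> cycle_faces G.
Proof.
move=> /subsetP sGF /cycle_facesP H; apply/cycle_facesP => e f eG fG.
by apply: H; apply: sGF.
Qed.

Lemma val_ordS x : val (ordS x) = if x.+1 == n then 0 else x.+1.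
Proof.
rewrite /=; case: eqP => [->|ne]; first by rewrite modnn.
by rewrite modn_small //; have := ltn_ord x; lia.
Qed.

Lemma cycle_edgeP e (s : {set 'I_n}) :
  (cycle_edge e \subset s) = (e \in s) && (ordS e \in s).
Proof. by rewrite subUset !sub1set. Qed.

(** An edge of index 1 modulo 3 occurs in no forbidden pair, so if [s] contains one it is an apex.
    Otherwise [s] contains no forbidden pair at all, because e_(3j) and e_(3j+2) together contain
    both ends of e_(3j+1); then any edge in [s] is an apex. *)
Lemma cycle_cone (s : {set 'I_n}) : has_generator cycle_edge s ->
  exists2 e, cycle_edge e \subset s &
  forall F, cycle_faces F -> flabel cycle_edge F \subset s -> cycle_faces (e |: F).
Proof.
move=> /existsP [e0 e0s].
case: (pickP (fun e : 'I_n => (e %% 3 == 1) && (cycle_edge e \subset s))).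
  move=> e /andP [/eqP e1 es]; exists e => // F /cycle_facesP H _.
  apply/cycle_facesP => x y; rewrite !inE.
  case/orP => [/eqP ->|xF]; first by lia.
  by case/orP => [/eqP ->|yF]; [lia | apply: H].
move=> none; exists e0 => // F /cycle_facesP H Fs.
have edge_s e : e \in e0 |: F -> cycle_edge e \subset s.
  by case/setU1P => [->//|eF]; apply: subset_trans Fs; apply: bigcup_sup eF.
apply/cycle_facesP => x y /edge_s + /edge_s + x3 yx.
rewrite !cycle_edgeP => /andP [_ Sx] /andP [ys _].
have Sxv : ordS x = x.+1 :> nat.
  by rewrite val_ordS; case: eqP => //; have := ltn_ord y; lia.
have := none (ordS x); rewrite cycle_edgeP Sx.
have -> : ordS (ordS x) = y.
  apply/val_inj; rewrite val_ordS Sxv; have := ltn_ord y.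
  by rewrite -[val y]/(nat_of_ord y) yx; case: eqP; lia.
by rewrite ys andbT Sxv; lia.
Qed.

(** The label consists of the initial vertices of the edges in [F] and the final vertices of those
    in [E], the ends of runs. [E] has at most one edge in each of the q + 1 groups of three: of two
    edges in a group, either the first is followed by the second, or they form a forbidden pair. *)
Lemma cycle_label_bound F : cycle_faces F ->
  (#|flabel cycle_edge F| <= #|F| + q.+1)%N.
Proof.
move=> /cycle_facesP H.
pose E := [set e in F | ordS e \notin F].
have cardE : (#|E| <= q.+1)%N.
  pose g (e : 'I_n) : 'I_q.+1 := inord (e %/ 3).
  rewrite -[q.+1]card_ord -(@card_in_imset _ _ g); first exact: max_card.
  move=> e f; rewrite !inE => /andP [eF Se] /andP [fF Sf] /(congr1 val).
  have bnd (x : 'I_n) : (x %/ 3 < q.+1)%N by have := ltn_ord x; lia.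
  rewrite /= !inordK // => eqd.
  wlog le_ef : e f eF Se fF Sf eqd / (e <= f)%N => [W|].
    by case: (leqP e f) => [|/ltnW] le; [|apply/esym]; apply: W.
  apply/val_inj => /=.
  have [//|[f1|f2]] : (e = f :> nat) \/ (f = e.+1 :> nat) \/
    ((3 %| e) /\ (f = e.+2 :> nat)) by lia.
  - case/negP: Se; suff -> : ordS e = f by [].
    apply/val_inj; rewrite val_ordS; have := ltn_ord f.
    by rewrite /= f1; case: eqP; lia.
  - by case: f2 => e3 f2; case: (H e f eF fF e3 f2).
have sub : flabel cycle_edge F \subset F :|: (@ordS n @: E).
  apply/bigcupsP => e eF; rewrite cycle_edgeP !inE eF /=.
  case: (boolP (ordS e \in F)) => //= Se.
  by apply: imset_f; rewrite inE eF.
apply: leq_trans (subset_leq_card sub) _; apply: leq_trans (leq_card_setU _ _) _.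
by rewrite leq_add2l (leq_trans (leq_imset_card _ _)).
Qed.

(** Each of the q complete groups misses one edge of its forbidden pair; [g] selects it. *)
Lemma cycle_face_card F : cycle_faces F -> (#|F| <= (2 * q).+2)%N.
Proof.
move=> /cycle_facesP H.
have : (q <= #|~: F|)%N.
  pose i0 (j : 'I_q) : 'I_n := inord (3 * j).
  pose i2 (j : 'I_q) : 'I_n := inord (3 * j).+2.
  have v0 j : i0 j = 3 * j :> nat by rewrite inordK //; have := ltn_ord j; lia.
  have v2 j : i2 j = (3 * j).+2 :> nat by rewrite inordK //; have := ltn_ord j; lia.
  pose g j := if i0 j \in F then i2 j else i0 j.
  rewrite -[q in (q <= _)%N]card_ord -(@card_imset _ _ g).
    apply/subset_leq_card/subsetP => x /imsetP [j _ ->]; rewrite inE /g.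
    case: ifP => [i0F|->//]; apply/negP => i2F.
    by apply: (H _ _ i0F i2F); rewrite v0 ?v2 // dvdn_mulr.
  move=> i j /(congr1 val) gij; apply/val_inj; move: gij; rewrite /g /=.
  by case: ifP; case: ifP; rewrite /= ?v0 ?v2; lia.
by have := cardsC F; rewrite card_ord; lia.
Qed.

(** * Edge sets covering all vertices of the cycle, and their signed count *)

Local Notation at_ F i := ((inord i : 'I_n) \in F).

Lemma atE F x : (x \in F) = at_ F (val x).
Proof. by rewrite inord_val. Qed.

Lemma at_U1 F i j : (i < n)%N -> (j < n)%N ->
  at_ ((inord i : 'I_n) |: F) j = (j == i) || at_ F j.
Proof. by move=> ltin ltjn; rewrite !inE -val_eqE /= !inordK. Qed.

(** Vertex i + 1 lies on the edges e_i and e_(i+1) only, and vertex 0 on the first and the last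
    edge. *)
Lemma flabel_fullP F : reflect
  (at_ F 0 || at_ F (3 * q).+1 /\
   forall i, (i < (3 * q).+1)%N -> at_ F i || at_ F i.+1)
  (flabel cycle_edge F == setT).
Proof.
have lastS : ordS (inord (3 * q).+1 : 'I_n) = inord 0.
  by apply/val_inj; rewrite val_ordS /= !inordK // eqxx.
have nextS i : (i < (3 * q).+1)%N -> ordS (inord i : 'I_n) = inord i.+1.
  by move=> lti; apply/val_inj; rewrite val_ordS /= !inordK; try lia; case: eqP; lia.
have memP x : reflect (exists2 e, e \in F & x \in cycle_edge e)
  (x \in flabel cycle_edge F) by exact: bigcupP.
apply: (iffP eqP) => [full|[H0 HS]].
  have in_full x : exists2 e, e \in F & x \in cycle_edge e.
    by apply/memP; rewrite full inE.
  split=> [|i lti].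
    have [e eF] := in_full (inord 0); rewrite !inE => /orP [/eqP ->|].
      by rewrite eF.
    by rewrite -lastS => /eqP /(@ordS_inj n) ->; rewrite eF orbT.
  have [e eF] := in_full (inord i.+1); rewrite !inE => /orP [/eqP ->|].
    by rewrite eF orbT.
  by rewrite -nextS // => /eqP /(@ordS_inj n) ->; rewrite eF.
apply/eqP; rewrite eqEsubset subsetT /=; apply/subsetP => x _; apply/memP.
case: (posnP x) => [x0|x_gt0].
  have xE : x = inord 0 by apply/val_inj; rewrite /= inordK; lia.
  case/orP: H0 => eF; eexists; try exact: eF; first by rewrite xE !inE eqxx.
  by rewrite xE -lastS !inE eqxx orbT.
have ltx : (x.-1 < (3 * q).+1)%N by have := ltn_ord x; lia.
have xE : x = inord x.-1.+1 by apply/val_inj; rewrite /= inordK; lia.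
case/orP: (HS _ ltx) => eF; eexists; try exact: eF; last by rewrite {1}xE !inE eqxx.
by rewrite {1}xE -nextS // !inE eqxx orbT.
Qed.

Hypothesis q_gt0 : (0 < q)%N.

(** The index of the edge before e_(3j): this is 3j - 1, or the last edge if j = 0. *)
Let prev j := if j is j'.+1 then (3 * j').+2 else (3 * q).+1.

Let stepbad F j := at_ F (prev j) && ~~ at_ F (3 * j).+2.

Let covers F := cycle_faces F && (flabel cycle_edge F == setT).

(** Both neighbours of e_(3j) are present, so its vertices are covered anyway, and its forbidden
    partner is absent. For j = q there is no partner, whence the guard [j < q]. *)
Lemma covers_U1 F j : (j < q.+1)%N -> at_ F (prev j) -> at_ F (3 * j).+1 ->
  ((j < q)%N -> ~~ at_ F (3 * j).+2) ->
  covers ((inord (3 * j) : 'I_n) |: F) = covers F.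
Proof.
move=> ltj Fp F1 F2; have ltn0 : (3 * j < n)%N by lia.
have faces : cycle_faces ((inord (3 * j) : 'I_n) |: F) = cycle_faces F.
  apply/idP/idP; first by apply: cycle_faces_sub; apply: subsetUr.
  move/cycle_facesP => H; apply/cycle_facesP => e f.
  case/setU1P => [->|eF] /setU1P [->|fF]; rewrite ?inordK //.
  - by lia.
  - move=> _ f2; have ltf := ltn_ord f; have ltjq : (j < q)%N by lia.
    by move: fF; rewrite atE /= f2; apply/negP/F2.
  - by lia.
  - exact: H.
rewrite /covers faces; congr (_ && _).
apply/flabel_fullP/flabel_fullP => -[H0 HS]; last first.
  split=> [|i lti]; (rewrite !at_U1; [|lia ..]).
    by case/orP: H0 => ->; rewrite !orbT.
  by case/orP: (HS i lti) => ->; rewrite !orbT.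
split=> [|i lti].
  case: (posnP j) => [j0|j_gt0]; first by move: Fp; rewrite j0 /= => ->; rewrite orbT.
  have ne0 : (0 == 3 * j) = false by lia.
  have nel : ((3 * q).+1 == 3 * j) = false by lia.
  by move: H0; rewrite !at_U1; [rewrite ne0 nel|lia ..].
case: (eqVneq i (3 * j)) => [->|ne1]; first by rewrite F1 orbT.
case: (eqVneq i.+1 (3 * j)) => [eq1|ne2].
  case: j Fp eq1 {ltj F1 F2 ltn0 faces H0 HS ne1} => [|j] /= Fp eq1; first by lia.
  have -> : i = (3 * j).+2 by lia.
  by rewrite Fp.
have := HS i lti; rewrite !at_U1; [|lia ..].
by rewrite (negbTE ne1) (negbTE ne2).
Qed.

(* Toggling e_(3j) cancels the covers that contain the edge preceding e_(3j) but
   not e_(3j + 2).  Among the others, those containing the last edge cancel by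
   toggling e_(3q), and the rest is the single set [F0] of 2q + 1 edges. *)
Lemma cycle_euler :
  (\sum_(F | cycle_faces F && (flabel cycle_edge F == setT)) (-1) ^+ #|F|
   = -1 :> int)%R.
Proof.
pose good i F := [forall j : 'I_i, ~~ stepbad F j].
have goodS i F : good i.+1 F = good i F && ~~ stepbad F i.
  apply/forallP/andP => [H|[/forallP H Hi] j].
    split; last exact: (H ord_max).
    by apply/forallP => j; apply: (H (widen_ord (leqnSn i) j)).
  case: (unliftP ord_max j) => [j' ->|->] //.
  by have := H j'; rewrite /= /bump leqNgt ltn_ord add0n.
(* The edges inspected by [stepbad] never have an index divisible by 3. *)
have good_U1 i j F : (j < q.+1)%N -> (i <= q)%N ->
    good i ((inord (3 * j) : 'I_n) |: F) = good i F.
  move=> ltj lei; apply: eq_forallb => x; have ltx := ltn_ord x.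
  rewrite /stepbad !at_U1; try lia; last by case: (val x) ltx => [|x'] /=; lia.
  have -> : (prev x == 3 * j) = false by case: (val x) ltx => [|x'] /=; lia.
  by have -> : ((3 * x).+2 == 3 * j) = false by lia.
have sum_good i : (i <= q)%N ->
   (\sum_(F | covers F) (-1) ^+ #|F| =
    \sum_(F | covers F && good i F) (-1) ^+ #|F| :> int)%R.
  elim: i => [_|i IHi lti].
    apply: eq_bigl => F; rewrite [good _ _](_ : _ = true) ?andbT //.
    by apply/forallP => -[].
  rewrite IHi; last exact: ltnW.
  rewrite (bigID (fun F => stepbad F i)) /= (_ : \sum_(F | _) _ = 0)%R ?add0r.
    by apply: eq_bigl => F; rewrite goodS andbA.
  apply: (toggle_sum0 (e := inord (3 * i) : 'I_n)) => F _.
  have bad_U1 : stepbad ((inord (3 * i) : 'I_n) |: F) i = stepbad F i.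
    rewrite /stepbad !at_U1; try lia; last by case: (i) lti => [|x'] /=; lia.
    have -> : (prev i == 3 * i) = false by case: (i) lti => [|x'] /=; lia.
    by have -> : ((3 * i).+2 == 3 * i) = false by lia.
  rewrite bad_U1; case bad: (stepbad F i); rewrite ?andbF // !andbT.
  have [Fp F2] := andP bad.
  rewrite good_U1; try lia.
  have [cov|] := boolP (covers F || covers ((inord (3 * i) : 'I_n) |: F)); last first.
    by case/norP => /negbTE -> /negbTE ->.
  rewrite covers_U1 //; try lia.
  (* Vertex 3i + 2 must be covered, and e_(3i+2) is absent; this leaves e_(3i+1). *)
  have F1' : at_ ((inord (3 * i) : 'I_n) |: F) (3 * i).+1.
    have full : flabel cycle_edge ((inord (3 * i) : 'I_n) |: F) == setT.
      case/orP: cov => /andP [_ full] //; rewrite eqEsubset subsetT /=.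
      by rewrite -(eqP full) flabelS // subsetUr.
    have [_ HS] := flabel_fullP _ full.
    have lt1 : ((3 * i).+1 < (3 * q).+1)%N by lia.
    have ne2 : ((3 * i).+2 == 3 * i) = false by lia.
    have := HS _ lt1; rewrite (at_U1 _ (j := (3 * i).+2)); [|lia ..].
    by rewrite ne2 (negbTE F2) /= orbF.
  have ne1 : ((3 * i).+1 == 3 * i) = false by lia.
  by move: F1'; rewrite at_U1; [rewrite ne1|lia ..].
rewrite -/(covers _) (eq_bigl covers) // (sum_good q) //.
rewrite (bigID (fun F => at_ F (3 * q).+1)) /=.
rewrite (_ : \sum_(F | _) _ = 0)%R ?add0r; last first.
  apply: (toggle_sum0 (e := inord (3 * q) : 'I_n)) => F _.
  rewrite good_U1 // at_U1; try lia.
  have -> : ((3 * q).+1 == 3 * q) = false by lia.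
  case last_in: (at_ F (3 * q).+1); rewrite ?andbF // !andbT /=.
  have [gF|] := boolP (good q F); rewrite ?andbF // !andbT.
  apply: covers_U1 => //; last by rewrite ltnn.
  (* Starting from the last edge, goodness propagates around the cycle: if the edge before e_(3j) is
     present, so is e_(3j+2), the edge before e_(3j+3). *)
  have chain j : (j <= q)%N -> at_ F (prev j).
    elim: j => [//|j IHj ltj]; have /forallP /(_ (Ordinal ltj)) := gF.
    by rewrite /stepbad /= (IHj (ltnW ltj)) negbK.
  exact: chain.
pose F0 := [set x : 'I_n | (x %% 3 != 2) && (x != (3 * q).+1 :> nat)].
have at_F0 i : (i < n)%N -> at_ F0 i = (i %% 3 != 2) && (i != (3 * q).+1).
  by move=> lti; rewrite inE inordK.
have card_F0 : #|F0| = (2 * q).+1.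
  (* The sequence 0, 1, 3, 4, 6, 7, ..., 3q enumerates [F0]. *)
  pose g (i : 'I_(2 * q).+1) : 'I_n := inord (i + i %/ 2).
  have gE i : g i = i + i %/ 2 :> nat by rewrite inordK //; have := ltn_ord i; lia.
  have -> : F0 = g @: setT.
    apply/setP => x; rewrite inE; apply/idP/imsetP => [x3|[i _ ->]]; last first.
      by rewrite gE; have := ltn_ord i; lia.
    exists (inord (2 * (x %/ 3) + x %% 3)) => //; apply/val_inj.
    by rewrite [RHS]/= -/(g _) gE inordK /=; have := ltn_ord x; lia.
  rewrite card_imset ?cardsT ?card_ord // => i j /(congr1 val).
  by rewrite /= !gE => eqij; apply/val_inj => /=; lia.
rewrite (big_pred1 F0) => [|F].
  by rewrite card_F0 exprS mulN1r mulnC exprM sqrr_sign.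
rewrite -/(covers F); apply/idP/eqP => [/andP [/andP [/andP [faces full] gF] nlast]|->].
  have /cycle_facesP H := faces; have [H0 HS] := flabel_fullP _ full.
  have at3 j : (j <= q)%N -> ~~ at_ F (prev j) -> at_ F (3 * j).
    case: j => [_ /= np|j ltj /= np].
      by move: H0; rewrite (negbTE np) orbF muln0.
    have -> : (3 * j.+1 = (3 * j).+3)%N by lia.
    by have := HS (3 * j).+2; rewrite (negbTE np); apply; lia.
  have n32 j : (j < q)%N -> at_ F (3 * j) -> ~~ at_ F (3 * j).+2.
    move=> ltj F3; apply/negP => F32; apply: (H _ _ F3 F32);
      by rewrite !inordK ?dvdn_mulr //; lia.
  (* Absence propagates as well: without the edge before e_(3j), covering vertex 3j requires e_(3j),
     which then forbids e_(3j+2). *)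
  have nprev j : (j <= q)%N -> ~~ at_ F (prev j).
    elim: j => [//|j IHj ltj] /=; apply: n32 => //; apply: at3; first exact: ltnW.
    exact/IHj/ltnW.
  apply/setP => x; rewrite inE atE; have := ltn_ord x; have := divn_eq x 3.
  have : (x %% 3 < 3)%N by rewrite ltn_mod.
  set j := (x %/ 3)%N; case: (x %% 3)%N => [|[|[|//]]] _ xE ltx.
  - have lej : (j <= q)%N by lia.
    have -> : val x = (3 * j)%N by rewrite /=; lia.
    rewrite (at3 _ lej (nprev _ lej)); apply/esym/eqP; lia.
  - have [eqj|ltj] : j = q \/ (j < q)%N by lia.
      have -> : val x = (3 * q).+1 by rewrite /=; lia.
      by rewrite (negbTE nlast); apply/esym; lia.
    have -> : val x = (3 * j).+1 by rewrite /=; lia.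
    have n2 := nprev j.+1 ltj; have := HS (3 * j).+1; rewrite (negbTE n2) orbF => -> /=.
      by apply/esym/eqP; lia.
    lia.
  - have ltj : (j < q)%N by lia.
    have -> : val x = (3 * j).+2 by rewrite /=; lia.
    by rewrite (negbTE (nprev j.+1 ltj)).
have nprev0 j : (j <= q)%N -> ~~ at_ F0 (prev j).
  by case: j => [_|j ltj] /=; rewrite at_F0; lia.
have faces0 : cycle_faces F0.
  by apply/cycle_facesP => e f; rewrite !inE; lia.
have full0 : flabel cycle_edge F0 == setT.
  by apply/flabel_fullP; split=> [|i lti]; rewrite !at_F0; lia.
rewrite /covers faces0 full0 (nprev0 0) // andbT /=.
by apply/forallP => j; rewrite /stepbad (negbTE (nprev0 j _)) // ltnW.
Qed.

End CycleComplex.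

(** * Homogenization *)

Section Homogenization.
Local Open Scope ring_scope.
Variables (k : fieldType) (n N : nat) (w : 'I_n -> nat).
Local Notation S := {mpoly k[n]}.

Definition mon (s : {set 'I_n}) : 'X_{1..n} :=
  [multinom (if v \in s then w v else 0%N) | v < n].

(** The largest set whose monomial divides x^d, so that multidegree [d] of the homogenized complex
    is the scalar strand of [room d]. *)
Definition room (d : 'X_{1..n}) : {set 'I_n} := [set v | (w v <= d v)%N].

Lemma mdeg_mon s : mdeg (mon s) = (\sum_(v in s) w v)%N.
Proof. by rewrite mdegE [RHS]big_mkcond; apply: eq_bigr => v _; rewrite mnmE. Qed.

Lemma mon_le s d : (mon s <= d)%MM = (s \subset room d).
Proof.
apply/mnm_lepP/subsetP => H v; first by move=> vs; have := H v; rewrite mnmE vs inE.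
by rewrite mnmE; case: ifP => // /H; rewrite inE.
Qed.

Lemma mon_mono (s t : {set 'I_n}) : s \subset t -> (mon s <= mon t)%MM.
Proof.
move=> /subsetP st; apply/mnm_lepP => v; rewrite !mnmE; case: ifP => // /st ->.
exact: leqnn.
Qed.

Lemma mon0 : mon set0 = 0%MM.
Proof. by apply/mnmP => v; rewrite !mnmE inE. Qed.

Lemma mcoeffMX_le (p : S) (m d : 'X_{1..n}) :
  (p * 'X_[m])@_d = if (m <= d)%MM then p@_(d - m) else 0.
Proof.
case: ifP => [le_md|nle]; first by rewrite -[d in LHS](submK le_md) addmC mcoeffMX.
rewrite [p]mpolyE mulr_suml raddf_sum /=; apply: big1 => e _.
rewrite -scalerAl -mpolyXD mcoeffZ mcoeffX; case: eqP => [eqd|_]; last by rewrite mulr0.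
by rewrite -eqd lem_addl in nle.
Qed.

Lemma subm_trans (a b d : 'X_{1..n}) : (b <= a)%MM -> (a <= d)%MM ->
  (d - a + (a - b) = d - b)%MM.
Proof.
move=> /mnm_lepP ba /mnm_lepP ad; apply/mnmP => v; rewrite !mnmE.
by rewrite addnBA // subnK.
Qed.

Variables (l : 'I_N -> {set 'I_n}) (h : 'I_N -> nat) (U : pred {set 'I_n}).
Variables (B : {set 'I_N}) (D : 'M[k]_N) (o : 'I_N).
Hypothesis resD : labelled_resolution l h U B D.
Hypothesis minD : forall a b, D a b != 0 -> l a != l b.
Hypothesis U_sub : forall s t : {set 'I_n}, s \subset t -> U s -> U t.
Hypothesis U_label : forall a, a \in B -> (0 < h a)%N -> U (l a).
Hypotheses (oB : o \in B) (ho : h o = 0%N) (lo : l o = set0).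
Hypothesis h_eq0 : forall a, a \in B -> h a = 0%N -> a = o.

Definition homog_diff : 'M[S]_N :=
  \matrix_(a, b) (D a b *: 'X_[mon (l a) - mon (l b)]).

Local Notation HD := homog_diff.

(** The shift by one arises because the ideal is resolved and not its quotient ring: the element [o]
    of degree 0 stands for the ring itself. *)
Definition basis i : {set 'I_N} := [set a in B | h a == i.+1].

Let on_basis i (x : 'rV[S]_N) := forall a, x 0 a != 0 -> a \in basis i.

Lemma labelled_le a b : D a b != 0 -> (mon (l b) <= mon (l a))%MM.
Proof. by case/(labelled_entry resD) => _ _ /mon_mono. Qed.

Lemma homog_diffK : HD *m HD = 0.
Proof.
apply/matrixP => a c; rewrite [LHS]mxE [RHS]mxE.
transitivity ((\sum_b D a b * D b c) *: 'X_[mon (l a) - mon (l c)] : S).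
  rewrite scaler_suml; apply: eq_bigr => b _; rewrite !mxE -scalerAl -scalerAr scalerA.
  have [->|Dab] := eqVneq (D a b) 0; first by rewrite !mul0r !scale0r.
  have [->|Dbc] := eqVneq (D b c) 0; first by rewrite !mulr0 !scale0r.
  by rewrite -mpolyXD subm_trans ?labelled_le.
have := congr1 (fun M : 'M_N => M a c) (labelled_diffK resD); rewrite !mxE => ->.
by rewrite scale0r.
Qed.

Section Exactness.
Variables (i : nat) (x : 'rV[S]_N).
Hypotheses (x_basis : on_basis i x) (xHD : x *m HD = 0).

Let part (d : 'X_{1..n}) : 'rV[k]_N :=
  \row_a (if (mon (l a) <= d)%MM then (x 0 a)@_(d - mon (l a)) else 0).

Let part_neq0 d a : part d 0 a != 0 ->
  [/\ (mon (l a) <= d)%MM, a \in B & h a = i.+1].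
Proof.
rewrite mxE; case: ifP => [le_ad nz|]; last by rewrite eqxx.
have /x_basis : x 0 a != 0.
  by apply: contra_neq nz => ->; rewrite mcoeff0.
by rewrite inE => /andP [-> /eqP].
Qed.

Let part_strand d : in_strand l B (room d) (part d).
Proof. by move=> a /part_neq0 [le aB _]; rewrite aB -mon_le le. Qed.

Let part_D d : part d *m D = 0.
Proof.
apply/rowP => b; rewrite [RHS]mxE mxE.
case: (boolP (mon (l b) <= d)%MM) => [le_bd|nle]; last first.
  apply: big1 => a _; have [->|Dab] := eqVneq (D a b) 0; first by rewrite mulr0.
  rewrite mxE ifF ?mul0r //; apply: contraNF nle => le_ad.
  exact: lepm_trans (labelled_le Dab) le_ad.
have := congr1 (fun y : 'rV_N => (y 0 b)@_(d - mon (l b))) xHD.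
rewrite !mxE mcoeff0 raddf_sum /= => sum0; rewrite -[RHS]sum0; apply: eq_bigr => a _.
rewrite !mxE -scalerAr mcoeffZ mcoeffMX_le [RHS]mulrC.
have [->|Dab] := eqVneq (D a b) 0; first by rewrite !mulr0.
have le_ba := labelled_le Dab; congr (_ * _).
have -> : (mon (l a) - mon (l b) <= d - mon (l b))%MM = (mon (l a) <= d)%MM.
  apply/mnm_lepP/mnm_lepP => le v; have := le v; rewrite !mnmBE.
    by have /mnm_lepP /(_ v) := le_ba; have /mnm_lepP /(_ v) := le_bd; lia.
  by move=> lev; apply: leq_sub2r.
case: ifP => // le_ad; congr (_@__); apply/mnmP => v; rewrite !mnmBE.
by have /mnm_lepP /(_ v) := le_ba; have /mnm_lepP /(_ v) := le_ad; lia.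
Qed.

(** If [U] fails for [room d], no element of positive degree has its label inside, so the component
    is 0. *)
Let part_lift d : exists2 u, in_strand l B (room d) u & part d = u *m D.
Proof.
case: (boolP (U (room d))) => [Ud|nU].
  exact: (labelled_exact resD Ud (@part_strand d) (part_D d)).
exists 0; first by move=> a; rewrite mxE eqxx.
rewrite mul0mx; apply/rowP => a; rewrite [RHS]mxE; apply/eqP.
apply: contraNT nU => nz; have [le aB ha] := part_neq0 nz.
by apply: (U_sub (s := l a)); [rewrite -mon_le | apply: U_label; rewrite ?ha].
Qed.

Let shifts : seq 'X_{1..n} := undup (flatten
  [seq [seq (m + mon (l a))%MM | m <- msupp (x 0 a)] | a <- enum 'I_N]).

Let sum_parts a : x 0 a = \sum_(d <- shifts) part d 0 a *: 'X_[d - mon (l a)].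
Proof.
apply/mpolyP => m; rewrite raddf_sum /=.
have part_m : part (m + mon (l a))%MM 0 a = (x 0 a)@_m.
  by rewrite mxE lem_addl addmK.
transitivity (\sum_(d <- shifts) if d == (m + mon (l a))%MM then (x 0 a)@_m else 0).
  rewrite -big_mkcond /=.
  case: (boolP ((m + mon (l a))%MM \in shifts)) => [ms|nms].
    by rewrite -big_filter filter_pred1_uniq ?undup_uniq // big_seq1.
  rewrite big_seq_cond big_pred0 => [|d]; last first.
    by apply/andP => -[ds /eqP ed]; rewrite ed (negbTE nms) in ds.
  apply: memN_msupp_eq0; apply: contra nms => mx.
  rewrite mem_undup; apply/flatten_mapP; exists a; first by rewrite mem_enum.
  exact: map_f.
apply: eq_bigr => d _; rewrite mcoeffZ mcoeffX.
case: eqP => [->|ne]; first by rewrite part_m addmK eqxx mulr1.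
have [->|/part_neq0 [le _ _]] := eqVneq (part d 0 a) 0; first by rewrite mul0r.
case: eqP => [eqm|]; last by rewrite mulr0.
by case: ne; rewrite -eqm submK.
Qed.

(** The claim splits over multidegrees: each component of [x] is a scalar cycle in the strand of
    [room d], and the scalar preimages are reassembled with monomial coefficients. *)
Lemma homog_exact : exists2 y, on_basis i.+1 y & x = y *m HD.
Proof.
pose u d := proj1_sig (constructive_indefinite_description _
  (let: ex_intro2 u us ue := part_lift d in ex_intro _ u (conj us ue))).
have [us uE] : (forall d, in_strand l B (room d) (u d)) /\
    (forall d, part d = u d *m D).
  by split=> d; rewrite /u; case: constructive_indefinite_description => ? [].
(* A scalar preimage under the total differential may have parts in other homological degrees; they
   are dropped and do not affect the coordinates of [x]. *)
pose y : 'rV[S]_N := \row_a (if a \in basis i.+1 then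
  \sum_(d <- shifts) u d 0 a *: 'X_[d - mon (l a)] else 0).
exists y; first by move=> a; rewrite mxE; case: ifP => //; rewrite eqxx.
apply/rowP => b; rewrite mxE.
case: (boolP (b \in basis i)) => [bi|nbi]; last first.
  have -> : x 0 b = 0 by apply/eqP; apply: contraNT nbi => /x_basis.
  rewrite big1 // => a _; rewrite !mxE; case: ifP => [ai|]; last by rewrite mul0r.
  have [->|Dab] := eqVneq (D a b) 0; first by rewrite scale0r mulr0.
  case/negP: nbi; have [_ bB _ hab] := labelled_entry resD Dab.
  by move: ai; rewrite !inE hab bB /= => /andP [_].
rewrite sum_parts.
transitivity (\sum_(d <- shifts) \sum_a
    (u d 0 a * D a b) *: 'X_[d - mon (l b)] : S).
  by apply: eq_bigr => d _; rewrite uE mxE scaler_suml.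
rewrite exchange_big /=; apply: eq_bigr => a _; rewrite !mxE.
have [->|Dab] := eqVneq (D a b) 0.
  by rewrite scale0r mulr0 big1 // => d _; rewrite mulr0 scale0r.
have [aB _ _ hab] := labelled_entry resD Dab.
have -> : a \in basis i.+1.
  by move: bi; rewrite !inE aB hab => /andP [_ /eqP ->] /=.
rewrite mulr_suml; apply: eq_bigr => d _.
have [->|nz] := eqVneq (u d 0 a) 0; first by rewrite mul0r !scale0r mul0r.
have /andP [_ la] := us d a nz.
by rewrite -scalerAl -scalerAr scalerA -mpolyXD subm_trans ?labelled_le ?mon_le.
Qed.

End Exactness.

(** * The homogenized complex as a minimal graded resolution *)

Definition homog_complex : free_complex n k :=
  @FreeComplex n k (fun i => #|basis i|)
    (fun i a => mdeg (mon (l (enum_val a))))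
    (fun i => \matrix_(a, b) HD (enum_val a) (enum_val b))
    (\col_a HD (enum_val a) o).

Local Notation F := homog_complex.

Let ext i (v : 'rV[S]_(#|basis i|)) : 'rV[S]_N :=
  \row_a (\sum_(j | enum_val j == a) v 0 j).

Let res i (x : 'rV[S]_N) : 'rV[S]_(#|basis i|) := \row_j x 0 (enum_val j).

Let res_ext i (v : 'rV[S]_(#|basis i|)) : res i (ext v) = v.
Proof.
apply/rowP => j; rewrite !mxE (big_pred1 j) // => j'.
by rewrite (inj_eq enum_val_inj).
Qed.

Let ext_basis i (v : 'rV[S]_(#|basis i|)) : on_basis i (ext v).
Proof.
move=> a; rewrite mxE; apply: contra_neqT => na.
by apply: big1 => j /eqP ja; move: na; rewrite -ja enum_valP.
Qed.

Let basis_inj i (x y : 'rV[S]_N) : on_basis i x -> on_basis i y ->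
  res i x = res i y -> x = y.
Proof.
move=> xi yi rxy; apply/rowP => a.
case: (boolP (a \in basis i)) => [ai|nai].
  have := congr1 (fun v : 'rV_(#|basis i|) => v 0 (enum_rank_in ai a)) rxy.
  by rewrite !mxE enum_rankK_in.
by apply: etrans (_ : 0 = _); [|apply: esym]; apply/eqP; apply: contraNT nai;
  [apply: xi | apply: yi].
Qed.

Let ext_HD i (v : 'rV[S]_(#|basis i|)) b :
  (ext v *m HD) 0 b = \sum_j v 0 j * HD (enum_val j) b.
Proof.
rewrite mxE (eq_bigr (fun a =>
    \sum_(j | enum_val j == a) v 0 j * HD (enum_val j) b)) => [|a _].
  rewrite (exchange_big_dep xpredT) //=; apply: eq_bigr => j _.
  by rewrite (big_pred1 (enum_val j)) // => a; rewrite eq_sym.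
by rewrite !mxE mulr_suml; apply: eq_bigr => j /eqP ->; rewrite mxE.
Qed.

Let HD_neq0 a b : HD a b != 0 -> D a b != 0.
Proof. by rewrite mxE; apply: contra_neq => ->; rewrite scale0r. Qed.

Let basis_HD i x : on_basis i.+1 x -> on_basis i (x *m HD).
Proof.
move=> xi b; rewrite mxE; apply: contra_neqT => nb; apply: big1 => a _.
have [->|/xi ai] := eqVneq (x 0 a) 0; first by rewrite mul0r.
have [->|/HD_neq0 Dab] := eqVneq (HD a b) 0; first by rewrite mulr0.
have [_ bB _ hab] := labelled_entry resD Dab.
by move: ai nb; rewrite !inE hab bB eqSS => /andP [_ ->].
Qed.

Let mul_diff i (v : 'rV[S]_(#|basis i.+1|)) :
  v *m fdiff F i = res i (ext v *m HD).
Proof.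
apply/rowP => b; rewrite [RHS]mxE ext_HD mxE.
by apply: eq_bigr => j _; rewrite !mxE.
Qed.

Let mul_aug (v : 'rV[S]_(#|basis 0|)) : (v *m faug F) 0 0 = (ext v *m HD) 0 o.
Proof. by rewrite ext_HD mxE; apply: eq_bigr => j _; rewrite !mxE. Qed.

Let mul_diff_eq0 i (v : 'rV[S]_(#|basis i.+1|)) :
  v *m fdiff F i = 0 <-> ext v *m HD = 0.
Proof.
rewrite mul_diff; split=> [r0|->]; last by apply/rowP => j; rewrite !mxE.
apply: (@basis_inj i); first exact/basis_HD/ext_basis.
  by move=> a; rewrite mxE eqxx.
by rewrite r0; apply/rowP => j; rewrite !mxE.
Qed.

Let mul_aug_eq0 (v : 'rV[S]_(#|basis 0|)) :
  v *m faug F = 0 <-> ext v *m HD = 0.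
Proof.
split=> [v0|HD0]; last by apply/rowP => j; rewrite ord1 mul_aug HD0 !mxE.
apply/rowP => b; rewrite [RHS]mxE.
have [->|nbo] := eqVneq b o; first by rewrite -mul_aug v0 mxE.
apply/eqP; rewrite mxE; apply: contra_neqT nbo => /eqP nz; apply/eqP.
apply: contraT => nbo; case: nz; apply: big1 => a _.
have [->|/ext_basis] := eqVneq (ext v 0 a) 0; first by rewrite mul0r.
rewrite inE => /andP [_ /eqP ha].
have [->|/HD_neq0 Dab] := eqVneq (HD a b) 0; first by rewrite mulr0.
have [_ bB _ hab] := labelled_entry resD Dab.
by case/eqP: nbo; apply: h_eq0 => //; move: hab; rewrite ha => -[].
Qed.

Variables (m : nat) (lam : 'I_m -> {set 'I_n}).
Hypothesis U_lam : forall e, U (lam e).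
Hypothesis label1 : forall a, a \in B -> h a = 1%N -> exists e, l a = lam e.

Definition monomial_ideal : S -> Prop :=
  idealgen predT (fun e => 'X_[mon (lam e)]).

(** The basis vector at [o] is a cycle in the strand of [lam e], so exactness makes it a boundary;
    homogenizing the preimage at the multidegree of the generator gives [x]. *)
Let image_lam e : exists x, on_basis 0 x /\ (x *m HD) 0 o = 'X_[mon (lam e)].
Proof.
have [||u us uE] := labelled_exact resD (U_lam e) (v := delta_mx 0 o).
- move=> a; rewrite mxE eqxx /=; case: (eqVneq a o) => [-> _|]; last by rewrite eqxx.
  by rewrite oB lo sub0set.
- rewrite -rowE; apply/rowP => b; rewrite !mxE; apply/eqP; apply: contraT.
  by case/(labelled_entry resD); rewrite ho.
exists (\row_a (if a \in basis 0 then u 0 a *: 'X_[mon (lam e) - mon (l a)] else 0)).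
split; first by move=> a; rewrite mxE; case: ifP => //; rewrite eqxx.
have := congr1 (fun v : 'rV_N => v 0 o) uE; rewrite !mxE !eqxx /= => sum1.
transitivity ((\sum_a u 0 a * D a o) *: 'X_[mon (lam e)] : S).
  rewrite scaler_suml; apply: eq_bigr => a _; rewrite !mxE.
  have [->|Dao] := eqVneq (D a o) 0; first by rewrite mulr0 !scale0r mulr0.
  have [aB _ _ ha] := labelled_entry resD Dao.
  rewrite inE aB ha ho /=.
  have [->|/us /andP [_ la]] := eqVneq (u 0 a) 0; first by rewrite mul0r !scale0r mul0r.
  rewrite -scalerAl -scalerAr scalerA -mpolyXD subm_trans ?labelled_le //;
    last exact: mon_mono.
  by rewrite lo mon0 subm0.
by rewrite -sum1 scale1r.
Qed.

Lemma homog_complex_image p :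
  monomial_ideal p <-> exists v : 'rV_(frank F 0), (v *m faug F) 0 0 = p.
Proof.
split=> [[c ->]|[v <-]].
  have [x hx] := fin_all_exists image_lam.
  exists (res 0 (\sum_e c e *: x e)).
  rewrite mul_aug (_ : ext _ = \sum_e c e *: x e); last first.
    apply: (@basis_inj 0); rewrite ?res_ext //.
    move=> a; rewrite summxE => nz; apply: contraNT nz => na.
    rewrite big1 // => e _; rewrite mxE; have [xe _] := hx e.
    have [->|/xe] := eqVneq (x e 0 a) 0; first by rewrite mulr0.
    by rewrite (negbTE na).
  rewrite mulmx_suml summxE; apply: eq_bigr => e _.
  by rewrite -scalemxAl mxE; have [_ ->] := hx e.
have [g hg] : exists g : 'I_(#|basis 0|) -> 'I_m,
    forall j, l (enum_val j) = lam (g j).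
  apply: (fin_all_exists (P := fun j e => l (enum_val j) = lam e)) => j.
  have := enum_valP j.
  by rewrite inE => /andP [jB /eqP hj]; apply: label1.
exists (fun e => \sum_(j | g j == e) v 0 j * (D (enum_val j) o)%:MP).
rewrite mxE (partition_big g predT) //=; apply: eq_bigr => e _.
rewrite mulr_suml; apply: eq_bigr => j /eqP gj.
by rewrite !mxE lo mon0 subm0 hg gj -mulrA mul_mpolyC.
Qed.

Lemma homog_complex_resolves : resolves monomial_ideal F.
Proof.
split=> [|v|i v]; first exact: homog_complex_image.
  rewrite mul_aug_eq0; split=> [v0|[u ->]].
    have [y yi vy] := homog_exact (@ext_basis 0 v) v0.
    exists (res 1 y); rewrite mul_diff -[LHS]res_ext vy; congr (res _ (_ *m _)).
    by apply: (@basis_inj 1) ; rewrite ?res_ext.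
  rewrite mul_diff (_ : ext (res _ _) = ext u *m HD).
    by rewrite -mulmxA homog_diffK mulmx0.
  apply: (@basis_inj 0); [exact: (@ext_basis _ _) | exact/basis_HD/ext_basis |].
  by rewrite res_ext.
rewrite mul_diff_eq0; split=> [v0|[u ->]].
  have [y yi vy] := homog_exact (@ext_basis i.+1 v) v0.
  exists (res i.+2 y); rewrite mul_diff -[LHS]res_ext vy; congr (res _ (_ *m _)).
  by apply: (@basis_inj i.+2) ; rewrite ?res_ext.
rewrite mul_diff (_ : ext (res _ _) = ext u *m HD).
  by rewrite -mulmxA homog_diffK mulmx0.
apply: (@basis_inj i.+1); [exact: (@ext_basis _ _) | exact/basis_HD/ext_basis |].
by rewrite res_ext.
Qed.

Hypothesis w_gt0 : forall v, (0 < w v)%N.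

Lemma homog_complex_minimal_resolution :
  minimal_graded_resolution monomial_ideal F.
Proof.
split; [split| exact: homog_complex_resolves |].
- move=> a; rewrite !mxE lo mon0 subm0; apply: rpredZ.
  by rewrite dhomogX.
- move=> i a b d; rewrite mxE [HD _ _]mxE.
  have [->|Dab] := eqVneq (D (enum_val a) (enum_val b)) 0.
    by rewrite scale0r msupp0.
  move/msuppZ_le; rewrite msuppX inE => /eqP -> /=.
  by rewrite -mdegD submK // labelled_le.
- move=> i a b; rewrite mxE [HD _ _]mxE.
  have [->|Dab] := eqVneq (D (enum_val a) (enum_val b)) 0.
    by rewrite scale0r mcoeff0.
  rewrite mcoeffZ mcoeffX; case: eqP => [sub0|]; last by rewrite mulr0.
  case/negP: (minD Dab); have [_ _ lba _] := labelled_entry resD Dab.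
  rewrite eqEsubset lba andbT; apply/subsetP => v va; apply: contraT => nvb.
  have := congr1 (fun d : 'X_{1..n} => d v) sub0.
  by rewrite mnmBE !mnmE va (negbTE nvb); have := w_gt0 v; lia.
Qed.

Lemma homog_complex_betti i j : betti F i j != 0%N <->
  exists a, [/\ a \in B, h a = i.+1 & (\sum_(v in l a) w v)%N = j].
Proof.
rewrite -lt0n; split=> [/card_gt0P [a]|[a [aB ha aj]]].
  rewrite inE => /eqP <-; exists (enum_val a); rewrite -mdeg_mon.
  by have := enum_valP a; rewrite inE => /andP [-> /eqP ->].
have ai : a \in basis i by rewrite inE aB ha /=.
apply/card_gt0P; exists (enum_rank_in ai a); rewrite inE /= enum_rankK_in //.
by rewrite mdeg_mon aj.
Qed.

End Homogenization.

(** * Regularity of weighted cycles *)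

Section Ideals.
Local Open Scope ring_scope.
Variables (k : fieldType) (n : nat).
Local Notation S := {mpoly k[n]}.

Lemma idealgen_sub (T T' : finType) (P : pred T) (P' : pred T')
    (g : T -> S) (g' : T' -> S) p :
  (forall t, P t -> exists2 t', P' t' & g t = g' t') ->
  idealgen P g p -> idealgen P' g' p.
Proof.
move=> sub [c ->].
(* [None] serves the indices outside [P], since [T'] may be empty. *)
have [f hf] : exists f : T -> option T', forall t, P t ->
    exists2 t', f t = Some t' & P' t' /\ g t = g' t'.
  apply: (fin_all_exists (P := fun t o => P t ->
    exists2 t', o = Some t' & P' t' /\ g t = g' t')) => t.
  case Pt: (P t); last by exists None.
  by have [t' Pt' gt] := sub t Pt; exists (Some t') => _; exists t'.
exists (fun t' => \sum_(t | P t && (f t == Some t')) c t).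
transitivity (\sum_(t | P t) \sum_(t' | P' t' && (f t == Some t')) c t * g' t').
  apply: eq_bigr => t Pt; have [t' ft [Pt' ->]] := hf t Pt.
  rewrite (big_pred1 t') // => t''; rewrite ft (inj_eq Some_inj) [t' == _]eq_sym.
  by rewrite /=; case: eqVneq => [->|]; rewrite ?Pt' ?andbF.
rewrite (exchange_big_dep P') /= => [|t t' _ /andP [] //].
apply: eq_bigr => t' Pt'; rewrite mulr_suml.
by apply: eq_bigl => t; rewrite Pt'.
Qed.

Lemma is_reg_ext (I J : S -> Prop) r :
  (forall p, I p <-> J p) -> is_reg I r -> is_reg J r.
Proof.
move=> IJ [F [[gF [imF ex0 ex] mF] bF leF]].
by exists F; split=> //; split=> //; split=> // p; rewrite -IJ.
Qed.

Lemma mon_set2 (w : 'I_n -> nat) x y : x != y ->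
  'X_[mon w [set x; y]] = 'X_x ^+ w x * 'X_y ^+ w y :> S.
Proof.
move=> ne_xy; rewrite !mpolyXn -mpolyXD; congr 'X_[_].
apply/mnmP => v; rewrite mnmDE !mulmnE !mnm1E mnmE !inE [v == x]eq_sym [v == y]eq_sym.
case: (eqVneq x v) => [<-|_]; first by rewrite eq_sym (negbTE ne_xy) mul1n addn0.
by case: (eqVneq y v) => [<-|_]; rewrite ?mul1n.
Qed.

End Ideals.

(** * The regularity for arbitrary positive weights *)

Section CycleRegularity.
Variables (k : fieldType) (q : nat).
Hypothesis q_gt0 : (0 < q)%N.
Local Notation n := (3 * q).+2.
Variable w : 'I_n -> nat.
Hypothesis w_gt0 : forall v, (0 < w v)%N.

Lemma sum_weightE (s : {set 'I_n}) :
  (\sum_(v in s) w v = #|s| + \sum_(v in s) (w v - 1))%N.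
Proof.
rewrite -sum1_card -big_split /=; apply: eq_bigr => v _.
by rewrite subnKC.
Qed.

Lemma cycle_is_reg :
  is_reg (@monomial_ideal k n w n (@cycle_edge q)) (\sum_v w v - 2 * q).
Proof.
have sumT : (\sum_v w v = n + \sum_v (w v - 1))%N.
  have := sum_weightE setT; rewrite cardsT card_ord => sumT.
  have inT (f : 'I_n -> nat) : (\sum_v f v = \sum_(v in setT) f v)%N.
    by apply: eq_bigl => v; rewrite inE.
  by rewrite !inT.
pose l (a : 'I_#|{: {set 'I_n}}|) := flabel (@cycle_edge q) (face a).
pose h (a : 'I_#|{: {set 'I_n}}|) := #|face a|.
have face_inj : injective (@face n) by exact: enum_val_inj.
have res0 : labelled_resolution l h (has_generator (@cycle_edge q)) _ _ :=
  taylor_resolution k (@cycle_faces_sub q) (@cycle_cone q).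
have [B [D [resD subB minD eulD]]] := minimalize_resolution res0.
have edge_label e (F : {set 'I_n}) : e \in F ->
    cycle_edge e \subset flabel (@cycle_edge q) F.
  by move=> eF; apply: (bigcup_sup e).
pose o : 'I_#|{: {set 'I_n}}| := enum_rank set0.
have face_o : face o = set0 by rewrite /face enum_rankK.
have lo : l o = set0 by rewrite /l face_o /flabel big_set0.
have label0 (F : {set 'I_n}) : flabel (@cycle_edge q) F = set0 -> F = set0.
  move=> F0; apply/setP => e; rewrite inE; apply: contraTF isT => eF.
  have := edge_label _ _ eF; rewrite F0 cycle_edgeP.
  by rewrite inE.
(* The empty face is the only one with empty label, so its Euler characteristic is 1 and it survives
   the cancellations. *)
have oB : o \in B.
  have : euler l h B set0 != 0%R.
    rewrite eulD taylor_euler (big_pred1 set0) ?cards0 // => F.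
    apply/andP/eqP => [[_ /eqP /label0 //]|->].
    rewrite /flabel big_set0 eqxx; split=> //; apply/cycle_facesP => e f.
    by rewrite inE.
  apply: contraNT => nB; apply/eqP/big1 => a.
  case/andP => aB /eqP /label0 a0; case/negP: nB.
  by rewrite (_ : o = a) //; apply: face_inj; rewrite face_o a0.
have inB a : a \in B -> cycle_faces (face a).
  by move/(subsetP subB); rewrite inE.
pose F := homog_complex w l h B D o.
have h0 a : a \in B -> h a = 0%N -> a = o.
  by move=> _ /eqP; rewrite cards_eq0 => /eqP a0; apply: face_inj; rewrite a0 face_o.
exists F; split.
- apply: (homog_complex_minimal_resolution resD minD) => //.
  + by move=> s t st /existsP [e es]; apply/existsP; exists e; apply: subset_trans st.
  + move=> a _; rewrite card_gt0 => /set0Pn [e ea].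
    by apply/existsP; exists e; apply: edge_label.
  + by rewrite /h face_o cards0.
  + by move=> e; apply/existsP; exists e.
  + by move=> a _ /eqP /cards1P [e ae]; exists e; rewrite /l ae /flabel big_set1.
- have [a [aB /eqP la oddh]] : exists a, [/\ a \in B, l a == setT & odd (h a)].
    have [/existsP [a /and3P [? ? ?]]|] :=
      boolP [exists a, [&& a \in B, l a == setT & odd (h a)]].
      by exists a.
    rewrite negb_exists => /forallP none.
    have : (0 <= euler l h B setT)%R.
      apply: sumr_ge0 => a /andP [aB la]; have := none a.
      by rewrite aB la /= -signr_odd => /negbTE ->.
    by rewrite eulD taylor_euler cycle_euler.
  exists (2 * q)%N; apply/homog_complex_betti.
  exists a; split=> //; last first.
    rewrite la subnK; last by rewrite sumT; lia.
    by apply: eq_bigl => v; rewrite inE.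
  (* The label bound gives degree at least 2q + 1, the size bound at most 2q + 2, and parity
     decides. *)
  have := cycle_face_card (inB a aB); have := cycle_label_bound (inB a aB).
  rewrite -/(l a) la cardsT card_ord -/(h a); lia.
- move=> i j /homog_complex_betti [a [aB ha <-]].
  have := cycle_label_bound (inB a aB); rewrite -/(l a) -/(h a) ha => bound.
  have : (\sum_(v in l a) (w v - 1) <= \sum_v (w v - 1))%N.
    by rewrite [leqRHS](bigID (mem (l a))) leq_addr.
  by rewrite sum_weightE sumT; lia.
Qed.

End CycleRegularity.

Theorem theorem4p5 (k : fieldType) (n : nat) (D : wograph n)
    (n_ge3 : (3 <= n)%N) (n_mod3 : (n = 2 %[mod 3])%N)
    (cycD : underlying D =2 cycle_graph n)
    (sinkD : forall x, x \in Vplus D -> sink D x) :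
  reg (wedge_ideal k D) =
    (reg (edge_ideal k (underlying D)) + \sum_(x in Vplus D) (weight D x - 1))%N.
Proof.
have [q q_gt0 nE] : exists2 q, (0 < q)%N & n = (3 * q).+2.
  by exists (n %/ 3); lia.
subst n.
have nxy x y : dedge D x y -> x != y.
  apply: contraTneq => ->; apply/negP => yy.
  by have := dedge_asym yy; rewrite yy.
have edge_sym x y : underlying D x y -> exists e, [set x; y] = @cycle_edge q e.
  rewrite cycD /cycle_graph => /orP [/eqP ->|/eqP ->]; first by exists x.
  by exists y; rewrite /cycle_edge setUC.
(* The tail of an edge is not a sink. Hence x_x may be written as x_x^(w x), and both ends of an
   edge are treated alike. *)
have w1 x y : dedge D x y -> weight D x = 1%N.
  move=> xy; apply/eqP; rewrite eqn_leq weight_gt0 andbT leqNgt; apply/negP => wx.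
  have /forallP /(_ y) : sink D x by apply: sinkD; rewrite inE.
  by rewrite /underlying xy /= (negbTE (dedge_asym xy)).
have edge_e e : underlying D e (ordS e) by rewrite cycD /cycle_graph eqxx.
have gen1 x y : dedge D x y ->
    ('X_x * 'X_y ^+ weight D y = 'X_[mon (weight D) [set x; y]] :> {mpoly k[_]})%R.
  by move=> xy; rewrite mon_set2 ?nxy // (w1 _ _ xy).
have gen2 x y : x != y ->
    ('X_x * 'X_y = 'X_[mon (fun=> 1%N) [set x; y]] :> {mpoly k[_]})%R.
  by move=> xy; rewrite mon_set2.
have nu x y : underlying D x y -> x != y.
  by case/orP => /nxy //; rewrite eq_sym.
have wE p : monomial_ideal (weight D) (@cycle_edge q) p <-> wedge_ideal k D p.
  split; apply: idealgen_sub; [move=> e _ | move=> [x y] /= xy].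
    have /orP [ed|ed] := edge_e e.
      by exists (e, ordS e); rewrite //= gen1.
    by exists (ordS e, e); rewrite //= gen1 // /cycle_edge setUC.
  have [|e xyE] := edge_sym x y; first by rewrite /underlying xy.
  by exists e; rewrite // gen1 // xyE.
have uE p : monomial_ideal (fun=> 1%N) (@cycle_edge q) p <->
    edge_ideal k (underlying D) p.
  split; apply: idealgen_sub; [move=> e _ | move=> [x y] /= xy].
    by exists (e, ordS e); rewrite //= gen2 // nu.
  have [e xyE] := edge_sym x y xy.
  by exists e; rewrite // gen2 ?nu // xyE.
(* The same computation is applied to the given weights and to the constant weight 1; the term 2q
   cancels in the difference. *)
rewrite (reg_eq (is_reg_ext wE (cycle_is_reg k q_gt0 (@weight_gt0 _ D)))).
rewrite (reg_eq (is_reg_ext uE (cycle_is_reg k q_gt0 (w := fun=> 1%N) (fun=> isT)))).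
have -> : (\sum_(x in Vplus D) (weight D x - 1) = \sum_x (weight D x - 1))%N.
  rewrite big_mkcond; apply: eq_bigr => x _; rewrite inE.
  by case: leqP; lia.
have -> : (\sum_x weight D x = (3 * q).+2 + \sum_x (weight D x - 1))%N.
  rewrite -[X in (X + _)%N]card_ord -sum1_card -big_split /=.
  by apply: eq_bigr => x _; rewrite subnKC ?weight_gt0.
by rewrite sum1_card card_ord; lia.
Qed.
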